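(* Suppose that $G$ is a definable group and $H\unlhd G$ is an invariant, normal subgroup of bounded index, which is $F_\sigma$ (equivalently, generated by a countable family of type-definable sets). Suppose in addition that $K\ge H$ is a pseudo-closed subgroup of $G$. If $H$ is not type-definable, then there is a small model $M$ and a homeomorphic embedding $\phi\colon 2^{\mathbf N}\to\mathcal P(K_M)$ (where $\mathcal P(K_M)$ is equipped with the sub-Vietoris topology) such that for any $\eta,\eta'\in 2^{\mathbf N}$: (1) $\phi(\eta)$ is a nonempty closed $G_\delta$; (2) if $\eta\mathrel{\mathbf E_0}\eta'$, then the saturations $[\phi(\eta)]_{E_H^M}$ and $[\phi(\eta')]_{E_H^M}$ are equal; (3) if $\eta\neq\eta'$, then $\phi(\eta)$ and $\phi(\eta')$ are disjoint; (4) if $\eta,\eta'$ are not $\mathbf E_0$-related, then the saturations $[\phi(\eta)]_{E_H^M}$ and $[\phi(\eta')]_{E_H^M}$ are disjoint.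
   Context: Conventions: we work in a monster model $\mathfrak C$ of a complete theory with infinite models (language of arbitrary cardinality): $\mathfrak C$ is $\kappa$-saturated and strongly $\kappa$-homogeneous for a sufficiently large cardinal $\kappa$. ''Small'' and ''bounded'' mean of cardinality $<\kappa$. Models are elementary substructures of $\mathfrak C$. ''Definable'', ''type-definable'', ''invariant'' mean without parameters unless stated otherwise. An invariant set is $F_\sigma$ if the corresponding subset of $S(\emptyset)$ is $F_\sigma$. A set is pseudo-closed if it is type-definable with parameters from some small set. For an $M$-invariant set $Z$, $Z_M=\{\mathrm{tp}(a/M):a\in Z\}\subseteq S(M)$ (a pseudo-closed $K\geq H$ as here is invariant over every model). $E_H$ is the relation on $G$ of lying in the same right coset of $H$; $E_H^M$ is the equivalence relation on $S_G(M)=G_M$ given by $p\mathrel{E_H^M}q$ iff there are $a\models p$, $b\models q$ with $a\mathrel{E_H}b$ (equivalently, for all such $a,b$). $[F]_{E_H^M}$ is the $E_H^M$-saturation of $F$. Sub-Vietoris topology on $\mathcal P(Z)$ (for a topological space $Z$): the topology generated by the subbasis of open sets $\{A\subseteq Z: A\cap K=\emptyset\}$ for $K\subseteq Z$ closed. $\mathbf E_0$ is the relation of eventual equality on $2^{\mathbf N}$. *)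

(* Defs.v *)
From HB Require Import structures.
From mathcomp Require Import all_boot all_order all_algebra.
From mathcomp Require Import all_classical all_reals all_analysis.
From mathcomp Require Import borel_hierarchy.

Set Implicit Arguments.
Unset Strict Implicit.
Unset Printing Implicit Defensive.

Local Open Scope classical_set_scope.

(* Cardinals are represented by types; [kappa : Type] below stands for the
   cardinality of [kappa]. *)
Definition card_lt {T U : Type} (A : set T) (B : set U) : Prop :=
  (A #<= B)%card /\ ~ (B #<= A)%card.

Definition small (kappa : Type) {T : Type} (A : set T) : Prop :=
  card_lt A [set: kappa].

Record language := Language {
  fsym : Type;
  farity : fsym -> nat;
  rsym : Type;
  rarity : rsym -> nat }.

Record structure (L : language) := Structure {
  carrier :> Type;
  fint : forall f : fsym L, ('I_(farity f) -> carrier) -> carrier;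
  rint : forall r : rsym L, set ('I_(rarity r) -> carrier) }.

Arguments fint {L} s f _.
Arguments rint {L} s r _.

(* [formula L A n] : formulas in the language [L] expanded by constants for the
   elements of [A], with free variables x_0, ..., x_{n-1}.  Variables are de
   Bruijn indices: a quantifier binds variable 0 and shifts the others. *)
Inductive term (L : language) (A : Type) (n : nat) : Type :=
| tcst (c : A)
| tvar (i : 'I_n)
| tapp (f : fsym L) (ts : 'I_(farity f) -> term L A n).

Inductive formula (L : language) (A : Type) (n : nat) : Type :=
| ffalse
| feq (t u : term L A n)
| frel (r : rsym L) (ts : 'I_(rarity r) -> term L A n)
| fimp (phi psi : formula L A n)
| fall (phi : formula L A n.+1).

Definition fnot {L : language} {A : Type} {n : nat} (phi : formula L A n)
    : formula L A n :=
  fimp phi (ffalse L A n).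

Definition extend_env {T : Type} {n : nat} (v : 'I_n -> T) (x : T)
    (i : 'I_n.+1) : T :=
  if unlift ord0 i is Some j then v j else x.

Definition tup (T : Type) (n : nat) : Type := 'I_n -> T.

Section Semantics.
Context {L : language} (C : structure L) {A : Type} (cst : A -> C).

Fixpoint teval {n : nat} (v : tup C n) (t : term L A n) : C :=
  match t with
  | tcst c => cst c
  | tvar i => v i
  | tapp f ts => fint C f (fun i => teval v (ts i))
  end.

Fixpoint sat {n : nat} (phi : formula L A n) : tup C n -> Prop :=
  match phi with
  | ffalse => fun _ => False
  | feq t u => fun v => teval v t = teval v u
  | frel r ts => fun v => rint C r (fun i => teval v (ts i))
  | fimp phi psi => fun v => sat phi v -> sat psi v
  | fall phi => fun v => forall x : C, sat phi (extend_env v x)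
  end.

End Semantics.

Definition sat0 {L : language} (C : structure L) {n : nat}
    (phi : formula L void n) (v : tup C n) : Prop :=
  sat (of_void C) phi v.

Section Substructures.
Context {L : language} (C : structure L).

Definition closed_under_functions (M : set C) : Prop :=
  forall (f : fsym L) (a : 'I_(farity f) -> C),
    (forall i, M (a i)) -> M (fint C f a).

Definition substructure (M : set C) (MC : closed_under_functions M)
    : structure L :=
  @Structure L {x : C | M x}
    (fun f a => exist M (fint C f (fun i => sval (a i)))
                  (MC f _ (fun i => svalP (a i))))
    (fun r => [set a | rint C r (fun i => sval (a i))]).

Definition elementary_substructure (M : set C) : Prop :=
  exists MC : closed_under_functions M,
    forall (n : nat) (phi : formula L void n) (v : tup (substructure MC) n),
      sat0 phi v <-> @sat0 L C n phi (fun i => sval (v i)).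

Definition automorphism (s : C -> C) : Prop :=
  [/\ bijective s,
      forall (f : fsym L) a, s (fint C f a) = fint C f (fun i => s (a i)) &
      forall (r : rsym L) a, rint C r a <-> rint C r (fun i => s (a i))].

Definition elementary_map (A : set C) (f : C -> C) : Prop :=
  forall (n : nat) (phi : formula L void n) (a : tup C n),
    (forall i, A (a i)) -> (sat0 phi a <-> sat0 phi (fun i => f (a i))).

End Substructures.

Section Types.
Context {L : language} (C : structure L).

Definition pformula (A : set C) (n : nat) : Type := formula L (set_type A) n.

Definition psat (A : set C) (n : nat) (a : tup C n) (phi : pformula A n) : Prop :=
  sat set_val phi a.

Definition complete_type (A : set C) (n : nat) (p : set (pformula A n)) : Prop :=
  (forall B : set (pformula A n), finite_set B -> B `<=` p ->
     exists a : tup C n, forall phi, B phi -> psat a phi) /\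
  (forall phi, p phi \/ p (fnot phi)).

(* S_n(A) *)
Definition type_space (A : set C) (n : nat) : Type :=
  {p : set (pformula A n) | complete_type p}.

HB.instance Definition _ (A : set C) (n : nat) := gen_eqMixin (type_space A n).
HB.instance Definition _ (A : set C) (n : nat) :=
  gen_choiceMixin (type_space A n).

Definition basic_clopen (A : set C) (n : nat) (phi : pformula A n)
    : set (type_space A n) :=
  [set p | sval p phi].

HB.instance Definition _ (A : set C) (n : nat) :=
  isSubBaseTopological.Build (type_space A n)
    (range (@basic_clopen A n)) id.

Lemma complete_type_of (A : set C) (n : nat) (a : tup C n) :
  complete_type [set phi : pformula A n | psat a phi].
Proof.
split; first by move=> B _ Ba; exists a => phi /Ba.
by move=> phi; case: (pselect (psat a phi)); [left|right].
Qed.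

Definition tp (A : set C) {n : nat} (a : tup C n) : type_space A n :=
  exist _ _ (complete_type_of A a).

Definition types_of (A : set C) {n : nat} (Z : set (tup C n))
    : set (type_space A n) := tp A @` Z.

Arguments types_of A {n} Z.

Definition definable {n : nat} (X : set (tup C n)) : Prop :=
  exists phi : formula L void n, X = [set a | sat0 phi a].

Definition type_definable_over (A : set C) {n : nat} (X : set (tup C n)) : Prop :=
  exists Phi : set (pformula A n),
    X = [set a | forall phi, Phi phi -> psat a phi].

Definition type_definable {n : nat} (X : set (tup C n)) : Prop :=
  type_definable_over set0 X.

Definition pseudo_closed (kappa : Type) {n : nat} (X : set (tup C n)) : Prop :=
  exists2 A : set C, small kappa A & type_definable_over A X.

Definition aut_invariant {n : nat} (X : set (tup C n)) : Prop :=
  forall s : C -> C, automorphism s ->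
    (fun (a : tup C n) i => s (a i)) @` X = X.

(* For invariant [X]: F_sigma as a subset of S_n(0). *)
Definition Fsigma_over0 {n : nat} (X : set (tup C n)) : Prop :=
  Fsigma (types_of set0 X).

Definition saturated (kappa : Type) : Prop :=
  forall (A : set C) (n : nat), small kappa A ->
    forall p : type_space A n, exists a : tup C n, tp A a = p.

Definition strongly_homogeneous (kappa : Type) : Prop :=
  forall (A : set C) (f : C -> C), small kappa A -> elementary_map A f ->
    exists2 s : C -> C, automorphism s & forall a, A a -> s a = f a.

(* No theory is mentioned: the models of complete theories with infinite models
   are exactly the infinite structures [C], the theory being that of [C].  The
   first two clauses say that kappa > |L| + aleph_0. *)
Definition monster (kappa : Type) : Prop :=
  [/\ small kappa [set: nat],
      small kappa [set: (fsym L + rsym L)%type],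
      infinite_set [set: C],
      saturated kappa &
      strongly_homogeneous kappa].

End Types.

Arguments tp {L C} A {n} a.
Arguments types_of {L C} A {n} Z.

(* The underlying set of the group is [gset]; the values of [gmul] and [ginv]
   outside [gset] are irrelevant. *)
Record group_in (T : Type) := GroupIn {
  gset : set T;
  gmul : T -> T -> T;
  gone : T;
  ginv : T -> T;
  gmul_in : forall x y, gset x -> gset y -> gset (gmul x y);
  gone_in : gset gone;
  ginv_in : forall x, gset x -> gset (ginv x);
  gmulA : forall x y z, gset x -> gset y -> gset z ->
    gmul x (gmul y z) = gmul (gmul x y) z;
  gmul1 : forall x, gset x -> gmul gone x = x /\ gmul x gone = x;
  gmulV : forall x, gset x -> gmul (ginv x) x = gone /\ gmul x (ginv x) = gone }.

Section Groups.
Context {T : Type} (G : group_in T).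

Definition subgroup (H : set T) : Prop :=
  [/\ H `<=` gset G, H (gone G),
      forall x y, H x -> H y -> H (gmul G x y) &
      forall x, H x -> H (ginv G x)].

Definition normal_subgroup (H : set T) : Prop :=
  subgroup H /\
  forall g h, gset G g -> H h -> H (gmul G (gmul G g h) (ginv G g)).

Definition rcoset_of (H : set T) (g : T) : set T :=
  [set gmul G h g | h in H].

Definition bounded_index (kappa : Type) (H : set T) : Prop :=
  small kappa [set rcoset_of H g | g in gset G].

(* E_H *)
Definition same_rcoset (H : set T) (a b : T) : Prop :=
  exists g, [/\ gset G g, rcoset_of H g a & rcoset_of H g b].

End Groups.

Definition definable_group {L : language} {C : structure L} {n : nat}
    (G : group_in (tup C n)) : Prop :=
  definable (gset G) /\
  definable [set w : tup C (n + n + n) |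
    let x : tup C n := fun i => w (lshift n (lshift n i)) in
    let y : tup C n := fun i => w (lshift n (rshift n i)) in
    let z : tup C n := fun i => w (rshift (n + n) i) in
    [/\ gset G x, gset G y & gmul G x y = z]].

Section CosetTypes.
Context {L : language} {C : structure L} {n : nat}.
Variables (G : group_in (tup C n)) (H : set (tup C n)) (M : set C).

(* E_H^M; for H a subgroup of G it only relates elements of G_M = S_G(M). *)
Definition coset_type_rel (p q : type_space M n) : Prop :=
  exists a b : tup C n, [/\ tp M a = p, tp M b = q & same_rcoset G H a b].

(* [F]_{E_H^M} *)
Definition saturation (F : set (type_space M n)) : set (type_space M n) :=
  [set q | types_of M (gset G) q /\ exists2 p, F p & coset_type_rel p q].

End CosetTypes.

Definition sub_vietoris (Z : topologicalType) : Type := set Z.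

HB.instance Definition _ (Z : topologicalType) := gen_eqMixin (sub_vietoris Z).
HB.instance Definition _ (Z : topologicalType) :=
  gen_choiceMixin (sub_vietoris Z).

Definition avoiding {Z : topologicalType} (K : set Z) : set (sub_vietoris Z) :=
  [set A : set Z | A `&` K = set0].

HB.instance Definition _ (Z : topologicalType) :=
  isSubBaseTopological.Build (sub_vietoris Z)
    [set K : set Z | closed K] (@avoiding Z).

Definition homeomorphic_embedding {X Y : topologicalType} (f : X -> Y) : Prop :=
  [/\ injective f, continuous f &
      forall U : set X, open U ->
        exists2 V : set Y, open V & f @` U = V `&` range f].

Definition E0 (eta eta' : cantor_space) : Prop :=
  \forall k \near \oo, eta k = eta' k.

(* Main.v *)
From HB Require Import structures.
Require Import Defs.
From mathcomp Require Import all_boot all_order all_algebra.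
From mathcomp Require Import all_classical all_reals all_analysis.
From mathcomp Require Import finmap borel_hierarchy.
(* so that [fsym] and [frel] denote function symbols and atomic formulas *)
Import Defs.

Set Implicit Arguments.
Unset Strict Implicit.
Unset Printing Implicit Defensive.

Local Open Scope classical_set_scope.

(** Write [H] as an increasing union of symmetric sets [B_m], type-definable
    without parameters, with [B_m B_m] contained in [B_(m+1)]
    ([closed_filtration]). Since [H] is not type-definable, it differs from every
    [B_m]. Choose a small model [M] that contains the parameters of [K],
    representatives of all the cosets of [H] and, for each [m], an element of [H]
    outside [B_m] ([ex_model]). Because of the representatives [r], the type over
    [M] of an element [a] of [G] determines its coset, and even some level [j] with
    [a r] in [B_j]. The group [H(M)] of the elements of [H] with entries in [M]
    acts on [K_M] by left multiplication, preserving each [E_H^M]-class.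

    By Zorn's lemma and compactness there is a minimal nonempty closed
    [H(M)]-invariant subset [Y] of [K_M]; each [H(M)]-orbit in [Y] is dense in [Y]
    ([orbit_dense]). The sets [B_m r^-1] have empty interior in [Y]
    ([thin_classes]): otherwise, by compactness, [H(M)]-translates of such an
    interior by elements of a single [B_k] would cover [Y], and [H(M)] would lie in
    one level of the filtration, against the choice of [M].

    Fix [a] in [Y]. Given a definable neighbourhood [D] of [a] and a level [N], the
    two facts above give [g] in [H(M)] with [g a] in [D] but far from [a] for the
    level [N], and hence a smaller neighbourhood [D'] of [a] such that [g D'] lies
    in [D] and no element of [B_N] carries a point of [D'] into [g D']
    ([splitting_step]). Iterating gives elements [g_m] and neighbourhoods [D_m]
    such that, with [c(eta,m)] the product of those [g_i], [i < m], for which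
    [eta i] is true, two pieces [c(eta,m+1) D_(m+1)] and [c(eta',m+1) D_(m+1)] with
    [eta m <> eta' m] are not related by any element of [B_m] ([ex_scheme],
    [piece_separated]). The map sends [eta] to the set of types realized in [K] and
    in all the pieces [c(eta,m) D_m]. If [eta] and [eta'] agree from [m] on, left
    multiplication by [c(eta',m) c(eta,m)^-1], which is in [H], carries one set
    into the other; if they differ infinitely often, the separation at arbitrarily
    high levels makes the saturations disjoint. Compactness gives nonemptiness and
    continuity for the sub-Vietoris topology; as the pieces of a given stage are
    disjoint and clopen, the map is also open onto its image.

    Sets of types over [M] are handled through their sets of realizations: a
    closed set of types corresponds to a set of tuples that is an intersection of
    sets definable over [M] ([closed_over]). *)

(** * Cardinal arithmetic *)

Lemma ex_choice (X Y : Type) (P : X -> Y -> Prop) :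
  (forall x, exists y, P x y) -> exists f, forall x, P x (f x).
Proof. by move=> /choice[f Pf]; exists f. Qed.

(** [T] has cardinality at most that of [U]. *)
Definition injects (T U : Type) : Prop := exists f : T -> U, injective f.

Lemma injects_trans (T U V : Type) : injects T U -> injects U V -> injects T V.
Proof. by move=> [f fi] [g gi]; exists (g \o f); exact: inj_comp. Qed.

(** Two points of the union of a chain and of [R0] already lie in the union of
    one member and of [R0]; the empty set counts as a member, so that an empty
    chain is no exception. *)
Lemma bigcup_chain2 (T : Type) (F : set (set T)) (R0 : set T) (x y : T) :
  total_on F subset ->
  (\bigcup_(X in F) X `|` R0) x -> (\bigcup_(X in F) X `|` R0) y ->
  exists X, [/\ F X \/ X = set0, (X `|` R0) x & (X `|` R0) y].
Proof.
move=> tF [[X FX Xx]|R0x] [[Y FY Yy]|R0y].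
- have [XY|YX] := tF _ _ FX FY.
    by exists Y; split; [left|left; exact: XY|left].
  by exists X; split; [left|left|left; exact: YX].
- by exists X; split; [left|left|right].
- by exists Y; split; [left|right|left].
- by exists set0; split; [right|right|right].
Qed.

Lemma bigcup_chain_sub (T : Type) (F : set (set T)) (R0 X : set T) :
  F X \/ X = set0 -> X `|` R0 `<=` \bigcup_(X in F) X `|` R0.
Proof.
move=> [FX|->] x [Xx|R0x].
- by left; exists X.
- by right.
- by [].
- by right.
Qed.

(** Comparability of cardinals, from a maximal partial injection. *)
Lemma injects_total (T U : Type) : injects T U \/ injects U T.
Proof.
pose P (R : set (T * U)) :=
  forall p q, R p -> R q -> (p.1 = q.1 <-> p.2 = q.2).
have [R [PR maxR]] : exists R, P R /\ forall S, R `<` S -> ~ P S.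
  apply: Zorn_bigcup => F FP tF p q Fp Fq.
  have [X [FX Xp Xq]] := bigcup_chain2 (R0 := set0) tF (or_introl Fp) (or_introl Fq).
  case: FX => [FX|X0]; last by move: Xp; rewrite X0 => -[].
  by case: Xp => // Xp; case: Xq => // Xq; exact: FP FX _ _ Xp Xq.
have [domR|/existsNP[t /forallNP Nt]] := pselect (forall t, exists u, R (t, u)).
  left; have [f Rf] := choice domR; exists f => x y fxy.
  exact: (PR _ _ (Rf x) (Rf y)).2.
have [ranR|/existsNP[u /forallNP Nu]] := pselect (forall u, exists t, R (t, u)).
  right; have [f Rf] := choice ranR; exists f => x y fxy.
  exact: (PR _ _ (Rf x) (Rf y)).1.
exfalso; apply: (maxR (R `|` [set (t, u)])).
  split; first by apply: subsetUl.
  by move=> /(_ (t, u)) RS; apply: (Nt u); apply: RS; right.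
move=> [p1 p2] [q1 q2] [Rp|[-> ->]] [Rq|[-> ->]] //=.
- exact: (PR _ _ Rp Rq).
- by split=> e; subst; [case: (Nt _ Rp)|case: (Nu _ Rp)].
- by split=> e; subst; [case: (Nt _ Rq)|case: (Nu _ Rq)].
Qed.

Section Square.
Variables (T : Type).

(** The field of a partial binary operation given by its graph. *)
Definition op_field (R : set ((T * T) * T)) : set T :=
  [set t | exists p, R p /\ [\/ t = p.1.1, t = p.1.2 | t = p.2]].

(** [R] is the graph of an injection [A * A -> A], with [A] the field of [R]. *)
Definition square_injection (R : set ((T * T) * T)) : Prop :=
  (forall p q, R p -> R q -> (p.1 = q.1 <-> p.2 = q.2)) /\
  (forall s t, op_field R s -> op_field R t -> exists u, R ((s, t), u)).

Lemma square_injection_nat (f : nat -> T) : injective f ->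
  square_injection
    [set p | exists i j, p = ((f i, f j), f (choice.pickle (i, j)))].
Proof.
move=> fi; split=> [_ _ [i [j ->]] [k [l ->]]/=|].
  split=> [[/fi-> /fi->]//|/fi/(pcan_inj (@choice.pickleK _))[-> ->]//].
move=> s t [_ [[i [j ->]] s_]] [_ [[k [l ->]] t_]] /=.
have [i' ->] : exists i', s = f i' by case: s_ => ->; eexists.
have [j' ->] : exists j', t = f j' by case: t_ => ->; eexists.
by eexists; exists i', j'.
Qed.

Lemma square_injection_maximal (R0 : set ((T * T) * T)) : square_injection R0 ->
  exists R, [/\ R0 `<=` R, square_injection R &
    forall S, R `<=` S -> square_injection S -> S `<=` R].
Proof.
move=> Q0; have [R [QR maxR]] :
    exists R, square_injection (R `|` R0) /\
      forall S, R `<` S -> ~ square_injection (S `|` R0).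
  apply: (@Zorn_bigcup _ (fun R => square_injection (R `|` R0))) => F FQ tF.
  have QX X : F X \/ X = set0 -> square_injection (X `|` R0).
    by move=> [/FQ//|->]; rewrite set0U.
  split=> [p q Fp Fq|s t [p [Fp sp]] [q [Fq tq]]].
    have [X [FX Xp Xq]] := bigcup_chain2 tF Fp Fq.
    exact: (QX X FX).1.
  have [X [FX Xp Xq]] := bigcup_chain2 tF Fp Fq.
  have [|//|u Xu] := (QX X FX).2 s t; [by exists p|by exists q|].
  by exists u; apply: (bigcup_chain_sub FX).
exists (R `|` R0); split=> // S RS QS p Sp; left; apply: contrapT => Rp.
apply: (maxR S).
  by split=> [x Rx|SR]; [apply: RS; left|apply/Rp/SR].
have -> : S `|` R0 = S; last by [].
by apply/setUidPl => x R0x; apply: RS; right.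
Qed.

(** An infinite cardinal equals its square. For a maximal [R] extending a pairing
    of a countable subset, with field [A], if the complement of [A] contained a
    copy [h A] of [A], then A * hA, hA * A and hA * hA could be mapped disjointly
    into [h A], extending [R]; hence the complement of [A] injects into [A]. *)
Theorem injects_square : injects nat T -> injects (T * T) T.
Proof.
move=> [iota iotai].
have [R [R0R [injR domR] maxR]] :=
  square_injection_maximal (square_injection_nat iotai).
pose A := op_field R.
have [f Rf] : exists f : T * T -> T,
    forall p, A p.1 -> A p.2 -> R (p, f p).
  apply: (@ex_choice _ _ (fun p u => A p.1 -> A p.2 -> R (p, u))) => -[s t] /=.
  have [As|NA] := pselect (A s /\ A t); last by exists s => ? ?; case: NA.
  by have [u Ru] := domR _ _ As.1 As.2; exists u.
have fA s t : A s -> A t -> A (f (s, t)).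
  by move=> As At; exists ((s, t), f (s, t)); split; [exact: Rf|constructor 3].
have finj s t s' t' : A s -> A t -> A s' -> A t' -> f (s, t) = f (s', t') ->
    s = s' /\ t = t'.
  move=> As At As' At' e.
  by have [] := (injR _ _ (Rf (s, t) As At) (Rf (s', t') As' At')).2 e.
have iotaA i : A (iota i).
  exists ((iota i, iota i), iota (choice.pickle (i, i))); split; last by constructor 1.
  by apply: R0R; exists i, i.
have iota_neq i j : iota i = iota j -> i = j by move/iotai.
have [[h hi]|[h hi]] := injects_total {t | A t} {t | ~ A t}; last first.
  (* tagging by two elements of A embeds the whole type into A *)
  have [e [eA ei]] : exists e : T -> T, (forall t, A (e t)) /\ injective e.
    have [e He] : exists e : T -> T, forall t,
        (exists2 At : A t, True & e t = f (iota 0, t)) \/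
        (exists2 At : ~ A t, True & e t = f (iota 1, sval (h (exist _ t At)))).
      apply: (@ex_choice _ _ (fun t u =>
        (exists2 At : A t, True & u = f (iota 0, t)) \/
        (exists2 At : ~ A t, True & u = f (iota 1, sval (h (exist _ t At)))))) => t.
      have [At|At] := pselect (A t).
        by exists (f (iota 0, t)); left; exists At.
      by exists (f (iota 1, sval (h (exist _ t At)))); right; exists At.
    exists e; split=> [t|t t'].
      have [[At _ ->]|[At _ ->]] := He t; apply: fA => //.
      exact: (svalP (h _)).
    have [[At _ ->]|[At _ ->]] := He t; have [[At' _ ->]|[At' _ ->]] := He t';
      move=> /finj[]//; try exact: (svalP (h _)).
    - by move=> /iota_neq.
    - by move=> /iota_neq.
    - by move=> _ /(eq_sig_hprop (fun x => @Prop_irrelevance _)) /hi [].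
  exists (fun p => f (e p.1, e p.2)) => -[s t] [s' t'] /= /finj[]// /ei-> /ei->.
  by [].
pose B := [set sval (h x) | x in [set: {t | A t}]].
have BN t : B t -> ~ A t by move=> [x _ <-]; exact: (svalP (h x)).
have {hi} [k [kB ki]] : exists k : T -> T, (forall t, A t -> B (k t)) /\
    (forall s t, A s -> A t -> k s = k t -> s = t) /\
    (forall b, B b -> exists2 t, A t & b = k t).
  have [k Hk] : exists k : T -> T, forall t (At : A t), k t = sval (h (exist _ t At)).
    apply: (@ex_choice _ _ (fun t u =>
      forall At : A t, u = sval (h (exist _ t At)))) => t.
    have [At|At] := pselect (A t); last by exists t => At'.
    by exists (sval (h (exist _ t At))) => At'; rewrite (Prop_irrelevance At At').
  exists k; split=> [t At|]; first by rewrite (Hk _ At); exists (exist _ t At).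
  split=> [s t As At|_ [[t At] _ <-]]; last by exists t => //; rewrite Hk.
  rewrite (Hk _ As) (Hk _ At).
  by move=> /(eq_sig_hprop (fun x => @Prop_irrelevance _)) /hi [].
move: ki => [kinj ksurj].
(* the tag [i] records which of the entries of a pair lie in [B] *)
pose code (i : nat) x y := k (f (iota i, f (x, y))).
pose S : set ((T * T) * T) := R `|` [set p | exists x y, A x /\ A y /\
  [\/ p = ((x, k y), code 0 x y), p = ((k x, y), code 1 x y) |
      p = ((k x, k y), code 2 x y)]].
have codeB i x y : A x -> A y -> B (code i x y) by move=> ? ?; exact/kB/fA/fA.
have code_inj i j x y x' y' : A x -> A y -> A x' -> A y' ->
    code i x y = code j x' y' -> [/\ i = j, x = x' & y = y'].
  move=> Ax Ay Ax' Ay' /(kinj _ _ (fA _ _ (iotaA i) (fA _ _ Ax Ay))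
    (fA _ _ (iotaA j) (fA _ _ Ax' Ay'))).
  move=> /(finj _ _ _ _ (iotaA i) (fA _ _ Ax Ay) (iotaA j) (fA _ _ Ax' Ay')).
  by move=> [/iota_neq -> /finj[]// -> ->].
have RA p : R p -> [/\ A p.1.1, A p.1.2 & A p.2].
  by move=> Rp; split; exists p; split=> //; [constructor 1|constructor 2|constructor 3].
have fieldS t : op_field S t -> A t \/ B t.
  move=> [p [[/RA[A1 A2 A3]|[x [y [Ax [Ay p_]]]]] t_]].
    by left; case: t_ => ->.
  by case: p_ t_ => -> [] /= ->; try (by left); right;
    (exact: kB || exact: codeB).
have kN x : A x -> ~ A (k x) by move=> /kB/BN.
have cN i x y : A x -> A y -> ~ A (code i x y) by move=> ? ?; exact/BN/codeB.
have QS : square_injection S.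
  split.
    move=> p q [Rp|[x [y [Ax [Ay p_]]]]] [Rq|[x' [y' [Ax' [Ay' q_]]]]].
    - exact: injR.
    - have [A1 A2 A3] := RA _ Rp; split=> e; exfalso; move: A1 A2 A3; rewrite e.
        by case: q_ => -> /= *; [apply: (kN y')|apply: (kN x')|apply: (kN x')].
      by case: q_ => -> /= *; [apply: (@cN 0 x' y')|apply: (@cN 1 x' y')|apply: (@cN 2 x' y')].
    - have [A1 A2 A3] := RA _ Rq; split=> e; exfalso; move: A1 A2 A3; rewrite -e.
        by case: p_ => -> /= *; [apply: (kN y)|apply: (kN x)|apply: (kN x)].
      by case: p_ => -> /= *; [apply: (@cN 0 x y)|apply: (@cN 1 x y)|apply: (@cN 2 x y)].
    - case: p_ => ->; case: q_ => -> /=;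
        (split; last by move=> /code_inj[] // e -> ->); move=> [e1 e2];
        try (by exfalso; first [by apply: (kN _ Ax); rewrite e1
          | by apply: (kN _ Ay); rewrite e2 | by apply: (kN _ Ax'); rewrite -e1
          | by apply: (kN _ Ay'); rewrite -e2]).
      + by rewrite e1 (kinj _ _ Ay Ay' e2).
      + by rewrite e2 (kinj _ _ Ax Ax' e1).
      + by rewrite (kinj _ _ Ay Ay' e2) (kinj _ _ Ax Ax' e1).
  move=> s t /fieldS[As|/ksurj[x Ax ->]] /fieldS[At|/ksurj[y Ay ->]].
  - by have [u Ru] := domR _ _ As At; exists u; left.
  - by exists (code 0 s y); right; exists s, y; do !split=> //; constructor 1.
  - by exists (code 1 x t); right; exists x, t; do !split=> //; constructor 2.
  - by exists (code 2 x y); right; exists x, y; do !split=> //; constructor 3.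
exfalso; apply: (kN (iota 0) (iotaA 0)).
have /RA[] // : R ((k (iota 0), k (iota 0)), code 2 (iota 0) (iota 0)).
apply: (maxR S) => //; first by apply: subsetUl.
by right; exists (iota 0), (iota 0); do !split=> //; constructor 3.
Qed.

End Square.

Lemma card_leT_injects (T U : Type) :
  ([set: T] #<= [set: U])%card <-> injects T U.
Proof.
split=> [/card_leP[f]|[f fi]].
  exists (fun t => val (f (exist _ t (mem_setT t)))) => t t' /val_inj e.
  by have [] := @inj _ _ _ f _ _ (mem_setT _) (mem_setT _) e.
have /card_eqPle[_ Tf] : (f @` [set: T] #= [set: T])%card.
  by apply: inj_card_eq => x y _ _; exact: fi.
by apply: card_le_trans Tf _; exact: subset_card_le.
Qed.

Lemma card_set_type (T : Type) (A : set T) : ([set: set_type A] #= A)%card.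
Proof.
have eA : @set_val T A @` [set: set_type A] = A.
  apply/seteqP; split=> [_ [x _ <-]|x Ax]; first exact: set_valP.
  by exists (exist _ x (mem_set Ax)).
have : (@set_val T A @` [set: set_type A] #= [set: set_type A])%card.
  by apply: inj_card_eq => x y _ _; exact: val_inj.
by rewrite eA card_eq_sym.
Qed.

Section Small.
Variables (kappa : Type).

Lemma small_card_le (T U : Type) (A : set T) (B : set U) :
  (A #<= B)%card -> small kappa B -> small kappa A.
Proof.
move=> AB [Bk kB]; split; first exact: card_le_trans AB Bk.
by move=> kA; apply: kB; exact: card_le_trans kA AB.
Qed.

Lemma small_set_type (T : Type) (A : set T) :
  small kappa A -> small kappa [set: set_type A].
Proof. by apply: small_card_le; have /card_eqPle[] := card_set_type A. Qed.

Hypothesis small_nat : small kappa [set: nat].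

(** A small upper bound of two small cardinals, the first one infinite. *)
Lemma small_bound2 (T U : Type) :
  small kappa [set: T] -> small kappa [set: U] -> injects nat T ->
  exists V, [/\ small kappa [set: V], injects nat V, injects T V & injects U V].
Proof.
move=> sT sU nT; have [TU|UT] := injects_total T U.
  by exists U; split=> //; [exact: injects_trans nT TU|exists id].
by exists T; split=> //; exists id.
Qed.

Lemma smallU (T : Type) (A B : set T) :
  small kappa A -> small kappa B -> small kappa (A `|` B).
Proof.
move=> sA sB.
have [V1 [sV1 nV1 _ AV1]] := small_bound2 small_nat (small_set_type sA)
  (ex_intro _ id (fun x y => id)).
have [V [sV nV V1V [b bi]]] := small_bound2 sV1 (small_set_type sB) nV1.
have [a ai] := injects_trans AV1 V1V.
have [c ci] := injects_square nV; have [d di] := nV.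
suff: injects (set_type (A `|` B)) V.
  move=> /card_leT_injects ABV; apply: small_card_le sV.
  by apply: card_le_trans ABV; have /card_eqPle[] := card_set_type (A `|` B).
have [f Hf] : exists f : set_type (A `|` B) -> V, forall x,
    (exists Ax : val x \in A, f x = c (d 0, a (exist _ (val x) Ax))) \/
    (exists Bx : val x \in B, f x = c (d 1, b (exist _ (val x) Bx))).
  apply: (@ex_choice _ _ (fun x y =>
    (exists Ax : val x \in A, y = c (d 0, a (exist _ (val x) Ax))) \/
    (exists Bx : val x \in B, y = c (d 1, b (exist _ (val x) Bx))))) => x.
  have [/mem_set Ax|/mem_set Bx] := set_valP x.
    by eexists; left; exists Ax.
  by eexists; right; exists Bx.
exists f => x y.
have [[Ax ->]|[Bx ->]] := Hf x; have [[Ay ->]|[By ->]] := Hf y => /ci[].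
- by move=> /ai[] /val_inj.
- by move=> /di.
- by move=> /di.
- by move=> /bi[] /val_inj.
Qed.

Lemma small_finite (T : Type) (A : set T) : finite_set A -> small kappa A.
Proof.
by move=> /finite_set_countable Ac; exact: small_card_le Ac small_nat.
Qed.

End Small.

(** * Counting formulas and the downward Loewenheim-Skolem theorem *)

Section SeqCode.
Variables (V : Type) (num : nat -> V) (pair : V * V -> V).
Hypotheses (numI : injective num) (pairI : injective pair).

(** Codes in an infinite type [V] with a pairing function. *)
Fixpoint seq_code (s : seq V) : V :=
  if s is x :: s' then pair (num 1, pair (x, seq_code s'))
  else pair (num 0, num 0).

Lemma seq_code_inj : injective seq_code.
Proof.
elim=> [|x s IH] [|y t] //= /pairI[].
- by move=> /numI.
- by move=> /numI.
- by move=> /pairI[-> /IH ->].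
Qed.

Lemma map_enum_ord_inj (n : nat) (X : Type) (f g : 'I_n -> X) :
  [seq f i | i <- enum 'I_n] = [seq g i | i <- enum 'I_n] -> f =1 g.
Proof.
by move=> /eq_in_map e i; apply: e; rewrite mem_enum.
Qed.

Section Code.
Variables (L : language) (A : Type).
Variables (csym : fsym L -> V) (crel : rsym L -> V) (ccst : A -> V).
Hypotheses (csymI : injective csym) (crelI : injective crel).
Hypothesis ccstI : injective ccst.

Fixpoint term_code (n : nat) (t : term L A n) : V :=
  match t with
  | tcst c => seq_code [:: num 0; ccst c]
  | tvar i => seq_code [:: num 1; num i]
  | tapp f ts => seq_code
      (num 2 :: csym f :: [seq term_code (ts i) | i <- enum 'I_(farity f)])
  end.

Lemma term_code_inj (n : nat) : injective (@term_code n).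
Proof.
elim=> [c|i|f ts IH] [c'|i'|f' ts'] /seq_code_inj; try by case=> /numI.
- by case=> /ccstI ->.
- by case=> /numI /val_inj ->.
- case=> /csymI ff'; case: f' / ff' ts' => ts' /map_enum_ord_inj e.
  by congr tapp; apply: funext => i; apply: IH; exact: e.
Qed.

Fixpoint formula_code (n : nat) (phi : formula L A n) : V :=
  match phi with
  | ffalse => seq_code [:: num 0]
  | feq t u => seq_code [:: num 1; term_code t; term_code u]
  | frel r ts => seq_code
      (num 2 :: crel r :: [seq term_code (ts i) | i <- enum 'I_(rarity r)])
  | fimp phi psi => seq_code [:: num 3; formula_code phi; formula_code psi]
  | fall phi => seq_code [:: num 4; formula_code phi]
  end.

Lemma formula_code_inj (n : nat) : injective (@formula_code n).
Proof.
move=> phi; elim: phi => {n} [n|n t u|n r ts|n phi IH psi IH'|n phi IH]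
  [|t' u'|r' ts'|phi' psi'|phi'] /seq_code_inj //; try by case=> /numI.
- by case=> /term_code_inj -> /term_code_inj ->.
- case=> /crelI rr'; case: r' / rr' ts' => ts' /map_enum_ord_inj e.
  by congr frel; apply: funext => i; apply: (@term_code_inj n); exact: e.
- by case=> /IH -> /IH' ->.
- by case=> /IH ->.
Qed.

End Code.
End SeqCode.

Section LoewenheimSkolem.
Context {L : language} (C : structure L).
Variables (x0 : C) (I : Type) (ar : I -> nat).
Variable op : forall i, ('I_(ar i) -> C) -> C.

(** A set closed under witnesses of failure of universal formulas is an
    elementary substructure as soon as it is closed under the functions. *)
Lemma elementary_of_witnesses (M : set C) : closed_under_functions M ->
  (forall (n : nat) (phi : formula L void n.+1) (v : tup C n),
    (forall i, M (v i)) -> (exists x, ~ sat0 phi (extend_env v x)) ->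
    exists2 x, M x & ~ sat0 phi (extend_env v x)) ->
  elementary_substructure M.
Proof.
move=> MC wit; exists MC => n phi.
have tevalM m (v : tup (substructure MC) m) (t : term L void m) :
    sval (teval (of_void (substructure MC)) v t) =
    teval (of_void C) (fun i => sval (v i)) t.
  by elim: t => //= f ts IH; congr fint; apply: funext => i.
rewrite /sat0; elim: phi => {n} [n|n t u|n r ts|n phi IH psi IH'|n phi IH] v //=.
- rewrite -!tevalM; split=> [->//|].
  exact: (eq_sig_hprop (fun x => @Prop_irrelevance _)).
- by under eq_fun do rewrite tevalM.
- by rewrite IH IH'.
- have env (x : substructure MC) :
      (fun i => sval (extend_env v x i)) =
      extend_env (fun i => sval (v i)) (sval x).
    by apply: funext => i; rewrite /extend_env; case: unliftP.
  split=> [allM|all x]; last by rewrite IH env; exact: all.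
  apply: contrapT => /existsNP/(wit _ _ _ (fun i => svalP (v i))) [x Mx Nphi].
  by apply: Nphi; have := allM (exist _ x Mx); rewrite IH env.
Qed.

(** The language of Skolem functions of [L], of the functions of [L] and of the
    operations [op]. *)
Definition skolem_language : language :=
  @Language ({n : nat & formula L void n.+1} + (fsym L + I))%type
    (fun f => match f with
              | inl s => projT1 s | inr (inl f) => farity f | inr (inr i) => ar i
              end)
    void (of_void nat).

(** A counterexample to [phi], if there is one. *)
Definition skolem (n : nat) (phi : formula L void n.+1) (v : tup C n) : C :=
  if pselect (exists x, ~ sat0 phi (extend_env v x)) is left ex
  then sval (cid ex) else x0.

Definition skolem_structure : structure skolem_language :=
  @Structure skolem_language C
    (fun f => match f return ('I_(@farity skolem_language f) -> C) -> C with
              | inl s => skolem (projT2 s)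
              | inr (inl f) => fint C f
              | inr (inr i) => @op i
              end)
    (fun r => match r with end).

(** The model is the Skolem hull of [S], that is, the set of values of the closed
    Skolem terms with constants in [S]; it is small because these terms embed
    into a small type. *)
Theorem loewenheim_skolem (kappa : Type) (S : set C) :
  small kappa [set: nat] -> small kappa [set: (fsym L + rsym L)%type] ->
  small kappa [set: I] -> small kappa S ->
  exists M : set C, [/\ elementary_substructure M, small kappa M, S `<=` M &
    forall i (a : 'I_(ar i) -> C), (forall j, M (a j)) -> M (op a)].
Proof.
move=> sN sL sI sS.
(* an infinite small V, closed under pairing, into which all symbols embed *)
have [V1 [sV1 nV1 _ LV1]] := small_bound2 sN sL (ex_intro _ id (fun x y => id)).
have [V2 [sV2 nV2 V12 SV2]] := small_bound2 sV1 (small_set_type sS) nV1.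
have [V [sV nV V2V [d dI]]] := small_bound2 sV2 sI nV2.
have [[pair pairI] [num numI]] := (injects_square nV, nV).
have [b bI] := injects_trans LV1 (injects_trans V12 V2V).
have [c cI] := injects_trans SV2 V2V.
pose cphi n := @formula_code V num pair L void (b \o inl) (b \o inr)
  (fun x => match x with end) n.
pose csym (f : fsym skolem_language) : V := seq_code num pair
  match f with
  | inl s => [:: num 0; num (projT1 s); cphi _ (projT2 s)]
  | inr (inl f) => [:: num 1; b (inl f)]
  | inr (inr i) => [:: num 2; d i]
  end.
have csymI : injective csym.
  move=> [[n phi]|[f|i]] [[m psi]|[g|j]] /(seq_code_inj numI pairI) //=;
    try by case=> /numI.
  - case=> /numI nm; case: m / nm psi => psi /formula_code_inj -> //.
    + by move=> x y /bI[].
    + by move=> x y /bI[].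

  - by case=> /bI[->].
  - by case=> /dI ->.
pose ev (t : term skolem_language (set_type S) 0) : C :=
  teval (C := skolem_structure) (@set_val C S) (fun=> x0) t.
have Mop (f : fsym skolem_language) (a : 'I_(farity f) -> C) :
    (forall i, range ev (a i)) -> range ev (fint skolem_structure f a).
  move=> /(_ _)/cid2-/all_sig2[t _ ta]; exists (tapp t) => //.
  by apply: (congr1 (fint skolem_structure f)); exact: funext.
exists (range ev); split.
- apply: elementary_of_witnesses => [f a Ma|n phi v Mv wphi].
    exact: (Mop (inr (inl f))).
  exists (skolem phi v); first exact: (Mop (inl (existT _ n phi))).
  by rewrite /skolem; case: pselect => // ex; exact: svalP (cid ex).
- apply: small_card_le sV; apply: card_le_trans (card_image_le _ _) _.
  apply/card_leT_injects.
  exists (@term_code V num pair skolem_language _ csym c 0).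
  exact: term_code_inj.
- by move=> s Ss; exists (tcst _ _ (exist _ s (mem_set Ss))).
- by move=> i a Ma; exact: (Mop (inr (inr i))).
Qed.

End LoewenheimSkolem.

(** * Definable sets *)

Section Substitution.
Context {L : language}.

(** Simultaneous replacement of constants and variables by constants or
    variables. *)
Definition atom_term {B : Type} {m : nat} (x : B + 'I_m) : term L B m :=
  match x with inl b => tcst L m b | inr i => tvar L B i end.

Definition atom_lift {B : Type} {m : nat} (x : B + 'I_m) : B + 'I_m.+1 :=
  match x with inl b => inl b | inr i => inr (lift ord0 i) end.

Fixpoint term_subst {A B : Type} {n m : nat} (c : A -> B + 'I_m)
    (s : 'I_n -> B + 'I_m) (t : term L A n) : term L B m :=
  match t with
  | tcst a => atom_term (c a)
  | tvar i => atom_term (s i)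
  | tapp f ts => tapp (fun i => term_subst c s (ts i))
  end.

Fixpoint formula_subst {A B : Type} {n m : nat} (c : A -> B + 'I_m)
    (s : 'I_n -> B + 'I_m) (phi : formula L A n) : formula L B m :=
  match phi with
  | ffalse => ffalse L B m
  | feq t u => feq (term_subst c s t) (term_subst c s u)
  | frel r ts => frel (fun i => term_subst c s (ts i))
  | fimp phi psi => fimp (formula_subst c s phi) (formula_subst c s psi)
  | fall phi => fall (formula_subst (fun a => atom_lift (c a))
      (fun i => if unlift ord0 i is Some j then atom_lift (s j) else inr ord0) phi)
  end.

Context (C : structure L).

Definition atom_eval {B : Type} {m : nat} (cst : B -> C) (v : tup C m)
    (x : B + 'I_m) : C :=
  match x with inl b => cst b | inr i => v i end.

Lemma teval_atom (B : Type) (m : nat) (cst : B -> C) (v : tup C m)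
    (x : B + 'I_m) : teval cst v (atom_term x) = atom_eval cst v x.
Proof. by case: x. Qed.

Lemma atom_eval_lift (B : Type) (m : nat) (cst : B -> C) (v : tup C m) (y : C)
    (x : B + 'I_m) :
  atom_eval cst (extend_env v y) (atom_lift x) = atom_eval cst v x.
Proof. by case: x => //= i; rewrite /extend_env liftK. Qed.

Lemma teval_subst (A B : Type) (n m : nat) (cst : B -> C) (c : A -> B + 'I_m)
    (s : 'I_n -> B + 'I_m) (t : term L A n) (v : tup C m) :
  teval cst v (term_subst c s t) =
  teval (fun a => atom_eval cst v (c a)) (fun i => atom_eval cst v (s i)) t.
Proof.
elim: t => /= [a|i|f ts IH]; rewrite ?teval_atom//.
by congr fint; apply: funext.
Qed.

Lemma sat_subst (A B : Type) (n m : nat) (cst : B -> C) (c : A -> B + 'I_m)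
    (s : 'I_n -> B + 'I_m) (phi : formula L A n) (v : tup C m) :
  sat cst (formula_subst c s phi) v <->
  sat (fun a => atom_eval cst v (c a)) phi (fun i => atom_eval cst v (s i)).
Proof.
elim: phi m c s v => {n} [n|n t u|n r ts|n phi IH psi IH'|n phi IH] m c s v //=.
- by rewrite !teval_subst.
- by under eq_fun do rewrite teval_subst.
- by rewrite IH IH'.
- have envE y : (fun i => atom_eval cst (extend_env v y)
        (if unlift ord0 i is Some j then atom_lift (s j) else inr ord0)) =
      extend_env (fun i => atom_eval cst v (s i)) y.
    apply: funext => i; rewrite {2}/extend_env; case: unliftP => [j _|_].
      exact: atom_eval_lift.
    by rewrite /= /extend_env unlift_none.
  have cstE y : (fun a => atom_eval cst (extend_env v y) (atom_lift (c a))) =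
      (fun a => atom_eval cst v (c a)).
    by apply: funext => a; exact: atom_eval_lift.
  by split=> + y => /(_ y); rewrite IH envE cstE.
Qed.

End Substitution.

(** Concatenation of tuples. *)
Definition tcat {T : Type} {k n : nat} (z : tup T k) (v : tup T n) : tup T (k + n) :=
  fun i => match fintype.split i with inl j => z j | inr j => v j end.

Lemma tcat_lshift (T : Type) (k n : nat) (z : tup T k) (v : tup T n) (i : 'I_k) :
  tcat z v (lshift n i) = z i.
Proof. by rewrite /tcat (unsplitK (inl i)). Qed.

Lemma tcat_rshift (T : Type) (k n : nat) (z : tup T k) (v : tup T n) (i : 'I_n) :
  tcat z v (rshift k i) = v i.
Proof. by rewrite /tcat (unsplitK (inr i)). Qed.

Lemma tcatP (T : Type) (k n : nat) (w : tup T (k + n)) (z : tup T k) (v : tup T n) :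
  (forall i, w (lshift n i) = z i) -> (forall i, w (rshift k i) = v i) ->
  w = tcat z v.
Proof.
move=> wz wv; apply: funext => i; rewrite -(splitK i).
by case: (fintype.split i) => j /=; rewrite ?tcat_lshift ?tcat_rshift.
Qed.

Section Definable.
Context {L : language} {C : structure L}.

(** Sets definable with parameters in [A]. *)
Definition definable_over (A : set C) {n : nat} (D : set (tup C n)) : Prop :=
  exists phi : pformula A n, forall a, D a <-> psat a phi.

Lemma definable_over_comp (A B : set C) (n m : nat) (D : set (tup C n))
    (s : 'I_n -> set_type B + 'I_m) : A `<=` B -> definable_over A D ->
  definable_over B [set v | D (fun i => atom_eval set_val v (s i))].
Proof.
move=> AB [phi Dphi].
pose c (a : set_type A) : set_type B + 'I_m :=
  inl (exist _ (val a) (mem_set (AB _ (set_valP a)))).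
by exists (formula_subst c s phi) => v; rewrite /= Dphi /psat sat_subst.
Qed.

Lemma definable_over_sub (A B : set C) (n : nat) (D : set (tup C n)) :
  A `<=` B -> definable_over A D -> definable_over B D.
Proof. by move=> AB /(definable_over_comp (fun i => inr i) AB). Qed.

Lemma definable_over0 (n : nat) (D : set (tup C n)) :
  definable D -> definable_over set0 D.
Proof.
move=> [phi ->].
exists (formula_subst (fun x : void => match x with end) (fun i => inr i) phi) => v.
rewrite /psat sat_subst /= /sat0.
by have -> : of_void C = (fun a : void => atom_eval set_val v
  match a return (set0 : set C) + 'I_n with end) by apply: funext; case.
Qed.

Lemma definable_overC (A : set C) (n : nat) (D : set (tup C n)) :
  definable_over A D -> definable_over A (~` D).
Proof. by move=> [phi Dphi]; exists (fnot phi) => a; rewrite /setC /= Dphi. Qed.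

Lemma definable_overI (A : set C) (n : nat) (D E : set (tup C n)) :
  definable_over A D -> definable_over A E -> definable_over A (D `&` E).
Proof.
move=> [phi Dphi] [psi Epsi]; exists (fnot (fimp phi (fnot psi))) => a.
rewrite /setI /= Dphi Epsi /psat /=; split=> [[? ?] /(_ _)|]; first exact.
by move=> h; split; apply: contrapT => h'; apply: h => // ? ?; exact: h'.
Qed.

Lemma definable_overT (A : set C) (n : nat) :
  definable_over A [set: tup C n].
Proof. by exists (fnot (ffalse _ _ _)) => a; split=> // _; exact: id. Qed.

Lemma definable_over_ex1 (A : set C) (n : nat) (D : set (tup C n.+1)) :
  definable_over A D -> definable_over A [set v | exists x, D (extend_env v x)].
Proof.
move=> [phi Dphi]; exists (fnot (fall (fnot phi))) => v; rewrite /psat /=.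
split=> [[x /Dphi Dx] /(_ x)//|/existsNP[x]].
by move/contrapT => Dx; exists x; apply/Dphi.
Qed.

(** Projections of definable sets are definable. *)
Lemma definable_over_ex (A : set C) (k n : nat) (D : set (tup C (k + n))) :
  definable_over A D ->
  definable_over A [set v | exists z : tup C k, D (tcat z v)].
Proof.
elim: k => [|k IH] in D *.
  move=> DD; suff -> : [set v | exists z, D (tcat z v)] = (D : set (tup C n)) by [].
  have tcat0 (z : tup C 0) (v : tup C n) : tcat z v = v.
    by apply/esym/(@tcatP _ 0 n) => [[]//|i]; congr v; exact: val_inj.
  apply/seteqP; split=> [v [z]|v Dv]; first by rewrite tcat0.
  have z : tup C 0 by case.
  by exists z; rewrite tcat0.
move=> /definable_over_ex1/IH [phi Dphi]; exists phi => v; rewrite -Dphi /=.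
have tcatS (z : tup C k) x : extend_env (tcat z v) x = tcat (extend_env z x) v.
  apply: (@tcatP _ k.+1 n) => i.
    rewrite /extend_env; case: (unliftP ord0 i) => [j ->|->].
      have -> : lshift n (lift ord0 j) = lift ord0 (lshift n j) by exact: val_inj.
      by rewrite liftK tcat_lshift.
    have -> : lshift n (ord0 : 'I_k.+1) = ord0 by exact: val_inj.
    by rewrite unlift_none.
  have -> : rshift k.+1 i = lift ord0 (rshift k i) by exact: val_inj.
  by rewrite /extend_env liftK tcat_rshift.
split=> [[z Dz]|[z [x]]]; last by rewrite tcatS; eexists; eassumption.
exists (fun i => z (lift ord0 i)), (z ord0); rewrite tcatS.
suff -> : extend_env (fun i => z (lift ord0 i)) (z ord0) = z by [].
by apply: funext => i; rewrite /extend_env; case: unliftP => [j ->|->].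
Qed.

End Definable.

(** * Type-definable sets and compactness *)

Section TypeDefinable.
Context {L : language} {C : structure L}.
Implicit Type A : set C.

(** [F] is an intersection of sets definable over [A], in a form that does not
    name the family; see [closed_over_type_definable]. *)
Definition closed_over A {n : nat} (F : set (tup C n)) : Prop :=
  forall a, (forall D, definable_over A D -> F `<=` D -> D a) -> F a.

(** [b] satisfies the type of [a] over [A]; this is symmetric, see
    [same_type_sym]. *)
Definition same_type A {n : nat} (a b : tup C n) : Prop :=
  forall D, definable_over A D -> D a -> D b.

Lemma closed_over_type_definable A (n : nat) (F : set (tup C n)) :
  closed_over A F <-> type_definable_over A F.
Proof.
split=> [clF|[Phi ->] a aF phi Phiphi].
  exists [set phi | F `<=` [set a | psat a phi]]; apply/seteqP; split.
    by move=> a Fa phi; exact.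
  move=> a aF; apply: clF => D [phi Dphi] FD; apply/Dphi/aF => b /FD.
  by move/Dphi.
by apply: (aF [set b | psat b phi]) => [|b]; [exists phi|exact].
Qed.

Lemma closed_over_definable A (n : nat) (D : set (tup C n)) :
  definable_over A D -> closed_over A D.
Proof. by move=> AD a; exact. Qed.

Lemma closed_over_sub A B (n : nat) (F : set (tup C n)) :
  A `<=` B -> closed_over A F -> closed_over B F.
Proof.
by move=> AB clF a aF; apply: clF => D /(definable_over_sub AB); exact: aF.
Qed.

Lemma closed_overI A (n : nat) (E F : set (tup C n)) :
  closed_over A E -> closed_over A F -> closed_over A (E `&` F).
Proof.
move=> clE clF a aEF; split; [apply: clE|apply: clF] => D AD sD; apply: aEF => //.
  by move=> b [/sD].
by move=> b [_ /sD].
Qed.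

Lemma closed_overU A (n : nat) (E F : set (tup C n)) :
  closed_over A E -> closed_over A F -> closed_over A (E `|` F).
Proof.
move=> clE clF a aEF; have [|NE] := pselect (E a); first by left.
right; apply: clF => D AD FD; apply: contrapT => NDa.
apply: NE; apply: clE => D' AD' ED'; apply: contrapT => ND'a.
have [] : (~` (~` D `&` ~` D')) a.
  apply: aEF; first by apply/definable_overC/definable_overI; exact: definable_overC.
  by move=> b [/ED' D'b|/FD Db] [].
by split.
Qed.

Lemma closed_over_bigI A (n : nat) (I : Type) (F : I -> set (tup C n)) :
  (forall i, closed_over A (F i)) -> closed_over A [set a | forall i, F i a].
Proof.
move=> clF a aF i; apply: clF => D AD FD; apply: aF => // b Fb; exact/FD/Fb.
Qed.

(** A point outside a closed set is separated from it by a definable set. *)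
Lemma closed_over_separated A (n : nat) (F : set (tup C n)) a :
  closed_over A F -> ~ F a -> exists D, [/\ definable_over A D, D a &
    forall b, D b -> ~ F b].
Proof.
move=> clF NFa; have : ~ forall D, definable_over A D -> F `<=` D -> D a.
  by move=> /clF.
move=> /existsNP[D /not_implyP[AD /not_implyP[FD NDa]]]; exists (~` D); split=> //.
  exact: definable_overC.
by move=> b NDb /FD.
Qed.

Lemma same_type_sym A (n : nat) (a b : tup C n) :
  same_type A a b -> same_type A b a.
Proof.
move=> ab D AD Db; apply: contrapT => NDa.
exact: (ab _ (definable_overC AD) NDa).
Qed.

Lemma closed_over_same_type A (n : nat) (F : set (tup C n)) (a b : tup C n) :
  closed_over A F -> same_type A a b -> F a -> F b.
Proof. by move=> clF ab Fa; apply: clF => D AD /(_ _ Fa); exact: ab. Qed.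

Lemma tp_same_type A (n : nat) (a b : tup C n) :
  tp A a = tp A b <-> same_type A a b.
Proof.
split=> [e D [phi Dphi] /Dphi Da|ab].
  apply/Dphi; have : sval (tp A a) phi by [].
  by rewrite e.
apply: (eq_sig_hprop (fun x => @Prop_irrelevance _)) => /=.
apply/seteqP; split=> phi /= phia.
  by apply: (ab [set c | psat c phi]) => //; exists phi.
by apply: ((same_type_sym ab) [set c | psat c phi]) => //; exists phi.
Qed.

Section Compactness.
Variable kappa : Type.
Hypothesis satC : saturated C kappa.

(** Compactness: the type of an ultrafilter refining [F] is realized. *)
Lemma realize_filter A (n : nat) (F : set_system (tup C n)) :
  small kappa A -> ProperFilter F ->
  exists a, forall D, definable_over A D -> F D -> D a.
Proof.
move=> sA PF; have [U [UU FU]] := ultraFilterLemma PF.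
pose p : set (pformula A n) := [set phi | U [set a | psat a phi]].
have cp : complete_type p.
  split=> [B finB Bp|phi].
    have [B' BE] := (finite_fsetP (T := {classic (pformula A n)}) (A := B)).1 finB.
    have : U (\bigcap_(phi in B) [set a | psat a phi]).
      rewrite BE; apply: (@filter_bigI _ {classic (pformula A n)}) => phi B'phi.
      by apply: Bp; rewrite BE.
    by move=> /filter_ex[a Ba]; exists a.
  exact: (in_ultra_setVsetC [set a | psat a phi] UU).
have [a ap] := satC sA (exist _ p cp).
exists a => D [phi Dphi] FD; apply/Dphi.
have : sval (tp A a) phi; last by [].
rewrite ap /= /p /=; apply: (filterS _ (FU _ FD)) => b.
by move/Dphi.
Qed.

(** The same for a filter base. *)
Lemma realize_base A (n : nat) (I : Type) (P : set I) (B : I -> set (tup C n)) :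
  small kappa A -> P !=set0 ->
  (forall i j, P i -> P j -> exists2 k, P k & B k `<=` B i `&` B j) ->
  (forall i, P i -> B i !=set0) ->
  exists a, forall D i, definable_over A D -> P i -> B i `<=` D -> D a.
Proof.
move=> sA P0 PB B0.
have PF : ProperFilter (filter_from P B).
  have FF : Filter (filter_from P B) by exact: filter_from_filter.
  exact: filter_from_proper.
have [a aD] := realize_filter sA PF.
by exists a => D i AD Pi BD; apply: aD => //; exists i.
Qed.

End Compactness.
End TypeDefinable.

Section Homogeneity.
Context {L : language} {C : structure L}.
Variable kappa : Type.
Hypothesis homC : strongly_homogeneous C kappa.
Hypothesis small_nat : small kappa [set: nat].

Lemma same_type_automorphism (n : nat) (a b : tup C n) : same_type set0 a b ->
  exists2 s : C -> C, automorphism s & forall i, s (a i) = b i.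
Proof.
move=> ab.
have ab_sub m (j : 'I_m -> 'I_n) (phi : formula L void m) :
    sat0 phi (fun i => a (j i)) <-> sat0 phi (fun i => b (j i)).
  have dj : definable_over set0 [set c : tup C n | sat0 phi (fun i => c (j i))].
    have d0 : definable_over set0 [set c : tup C m | sat0 phi c].
      by apply: definable_over0; exists phi.
    exact: (definable_over_comp (fun i => inr (j i)) (@subset_refl _ set0) d0).
  by split; [exact: (ab _ dj)|exact: (same_type_sym ab dj)].
have [f fab] : exists f : C -> C, forall i, f (a i) = b i.
  have [f Hf] : exists f : C -> C, forall x, forall i, a i = x -> f x = b i.
    apply: (@ex_choice _ _ (fun x y => forall i, a i = x -> y = b i)) => x.
    have [[i ai]|Nx] := pselect (exists i, a i = x); last first.
      by exists x => i ai; case: Nx; exists i.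
    exists (b i) => k ak.
    pose phi : formula L void 2 := feq (tvar _ _ ord0) (tvar _ _ ord_max).
    have := ab_sub _ (fun u : 'I_2 => if u == ord0 then i else k) phi.
    by rewrite /sat0 /= => -[+ _]; apply; rewrite ai ak.
  by exists f => i; exact: Hf.
have [|m phi c ca|s auts sf] := homC (A := range a) (f := f).
- by apply: small_finite => //; exact: finite_image.
- have /(_ _)/cid-/all_sig[j cj] : forall i, exists k, a k = c i.
    by move=> i; have [k _ <-] := ca i; exists k.
  have -> : c = fun i => a (j i) by apply: funext.
  by under [X in _ <-> sat0 _ X]eq_fun do rewrite fab; exact: ab_sub.
- by exists s => // i; rewrite sf//; exists i.
Qed.

End Homogeneity.

(** * Definable groups *)

Section Sections.
Context {L : language} {C : structure L}.
Implicit Type A : set C.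

Lemma definable_over_lshift A (k n : nat) (D : set (tup C k)) :
  definable_over A D ->
  definable_over A [set w : tup C (k + n) | D (fun i => w (lshift n i))].
Proof.
by move=> AD; exact: (definable_over_comp (fun i => inr (lshift n i)) (@subset_refl _ A) AD).
Qed.

Lemma definable_over_sectionl A (k n : nat) (D : set (tup C (k + n))) (c : tup C k) :
  (forall i, A (c i)) -> definable_over A D ->
  definable_over A [set v : tup C n | D (tcat c v)].
Proof.
move=> Ac AD; pose s (i : 'I_(k + n)) : set_type A + 'I_n :=
  match fintype.split i with
  | inl j => inl (exist _ (c j) (mem_set (Ac j))) | inr j => inr j end.
have := definable_over_comp s (@subset_refl _ A) AD.
suff -> : [set v | D (fun i => atom_eval set_val v (s i))] = [set v | D (tcat c v)] by [].
apply: eq_set => v; congr D; apply: funext => i; rewrite /s /tcat.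
by case: fintype.split.
Qed.

Lemma definable_over_sectionr A (k n : nat) (D : set (tup C (k + n))) (c : tup C n) :
  (forall i, A (c i)) -> definable_over A D ->
  definable_over A [set v : tup C k | D (tcat v c)].
Proof.
move=> Ac AD; pose s (i : 'I_(k + n)) : set_type A + 'I_k :=
  match fintype.split i with
  | inr j => inl (exist _ (c j) (mem_set (Ac j))) | inl j => inr j end.
have := definable_over_comp s (@subset_refl _ A) AD.
suff -> : [set v | D (fun i => atom_eval set_val v (s i))] = [set v | D (tcat v c)] by [].
apply: eq_set => v; congr D; apply: funext => i; rewrite /s /tcat.
by case: fintype.split.
Qed.

End Sections.

Section DefinableGroup.
Context {L : language} {C : structure L} {n : nat}.
Variable G : group_in (tup C n).
Hypothesis defG : definable_group G.
Implicit Types (A : set C) (D E F : set (tup C n)).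

Lemma definable_gset A : definable_over A (gset G).
Proof. exact: (definable_over_sub (@sub0set _ A) (definable_over0 defG.1)). Qed.

(** The graph of multiplication, read on concatenated triples. *)
Lemma definable_graph A : exists Gamma : set (tup C (n + n + n)),
  definable_over A Gamma /\
  forall x y z, Gamma (tcat (tcat x y) z) <-> [/\ gset G x, gset G y & gmul G x y = z].
Proof.
eexists; split.
  exact: (definable_over_sub (@sub0set _ A) (definable_over0 defG.2)).
move=> x y z /=.
have -> : (fun i => tcat (tcat x y) z (lshift n (lshift n i))) = x.
  by apply: funext => i; rewrite !tcat_lshift.
have -> : (fun i => tcat (tcat x y) z (lshift n (rshift n i))) = y.
  by apply: funext => i; rewrite tcat_lshift tcat_rshift.
have -> // : (fun i => tcat (tcat x y) z (rshift (n + n) i)) = z.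
by apply: funext => i; rewrite tcat_rshift.
Qed.

(** The preimage of a definable set under multiplication. *)
Lemma definable_over_mul A D : definable_over A D ->
  exists D2 : set (tup C (n + n)), definable_over A D2 /\
    forall x y, D2 (tcat x y) <-> [/\ gset G x, gset G y & D (gmul G x y)].
Proof.
move=> AD; have [Gamma [AG GammaE]] := definable_graph A.
pose s (i : 'I_(n + n + n)) : set_type A + 'I_(n + (n + n)) :=
  match fintype.split i with
  | inl j => inr (rshift n j) | inr j => inr (lshift (n + n) j) end.
have Gs := definable_over_comp s (@subset_refl _ A) AG.
have := definable_over_ex (definable_overI Gs (definable_over_lshift (n + n) AD)).
move=> AD2; eexists; split; first exact: AD2.
move=> x y; rewrite /=.
have sE z : (fun i => atom_eval set_val (tcat z (tcat x y)) (s i)) =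
    tcat (tcat x y) z.
  apply: funext => i; rewrite /s [RHS]/tcat.
  by case: fintype.split => j /=; rewrite ?tcat_rshift ?tcat_lshift.
have lE z : (fun i => tcat z (tcat x y) (lshift (n + n) i)) = z.
  by apply: funext => i; rewrite tcat_lshift.
split=> [[z []]|[Gx Gy Dxy]].
  by rewrite /= sE lE => /GammaE[Gx Gy <-].
by exists (gmul G x y); split; rewrite /= ?lE// sE; apply/GammaE.
Qed.

Lemma definable_over_ltranslate A D (c : tup C n) : (forall i, A (c i)) ->
  gset G c -> definable_over A D ->
  definable_over A [set x | gset G x /\ D (gmul G c x)].
Proof.
move=> Ac Gc /definable_over_mul[D2 [AD2 D2E]].
have := definable_over_sectionl Ac AD2.
suff -> : [set x | D2 (tcat c x)] = [set x | gset G x /\ D (gmul G c x)] by [].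
by apply/seteqP; split=> x /=; rewrite D2E => -[].
Qed.

Lemma definable_over_rtranslate A D (c : tup C n) : (forall i, A (c i)) ->
  gset G c -> definable_over A D ->
  definable_over A [set x | gset G x /\ D (gmul G x c)].
Proof.
move=> Ac Gc /definable_over_mul[D2 [AD2 D2E]].
have := definable_over_sectionr Ac AD2.
suff -> : [set x | D2 (tcat x c)] = [set x | gset G x /\ D (gmul G x c)] by [].
by apply/seteqP; split=> x /=; rewrite D2E => -[].
Qed.

Lemma definable_over_image A D (c : tup C n) : (forall i, A (c i)) ->
  gset G c -> definable_over A D -> D `<=` gset G ->
  definable_over A [set gmul G c y | y in D].
Proof.
move=> Ac Gc AD DG; have [Gamma [AG GammaE]] := definable_graph A.
pose s (i : 'I_(n + n + n)) : set_type A + 'I_(n + n) :=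
  match fintype.split i with
  | inl j => match fintype.split j with
             | inl k => inl (exist _ (c k) (mem_set (Ac k)))
             | inr k => inr (lshift n k) end
  | inr j => inr (rshift n j) end.
have Gs := definable_over_comp s (@subset_refl _ A) AG.
have := definable_over_ex (definable_overI Gs (definable_over_lshift n AD)).
have sE y x : (fun i => atom_eval set_val (tcat y x) (s i)) = tcat (tcat c y) x.
  apply: funext => i; rewrite /s [RHS]/tcat.
  case: fintype.split => j /=; last by rewrite tcat_rshift.
  by rewrite {2}/tcat; case: fintype.split => k //=; rewrite tcat_lshift.
have lE (y x : tup C n) : (fun i => tcat y x (lshift n i)) = y.
  by apply: funext => i; rewrite tcat_lshift.
set X := [set v | _]; suff -> : X = [set gmul G c y | y in D] by [].
apply/seteqP; split=> [x [y []]|_ [y Dy <-]] /=.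
  by rewrite sE lE => /GammaE[_ _ <-] Dy; exists y.
exists y; split; rewrite /= ?lE// sE; apply/GammaE; split=> //; exact: DG.
Qed.

Lemma closed_over_rtranslate A F (c : tup C n) : (forall i, A (c i)) ->
  gset G c -> closed_over A F ->
  closed_over A [set x | gset G x /\ F (gmul G x c)].
Proof.
move=> Ac Gc clF a aF; split.
  by apply: aF; [exact: definable_gset|move=> x []].
apply: clF => D AD FD.
have [|x [Gx Fx]|//] := aF [set x | gset G x /\ D (gmul G x c)].
  exact: definable_over_rtranslate.
by split=> //; exact: FD.
Qed.

(** The set of all [y^-1 x] with [y] in [F] and [x] in [E]. *)
Definition left_quotient F E : set (tup C n) :=
  [set z | gset G z /\ exists y, [/\ gset G y, F y & E (gmul G y z)]].

Lemma definable_over_left_quotient A D E : definable_over A D ->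
  definable_over A E -> definable_over A (left_quotient D E).
Proof.
move=> AD /definable_over_mul[E2 [AE2 E2E]].
have := definable_over_ex (definable_overI (definable_over_lshift n AD) AE2).
suff -> : [set v | exists z, ([set w | D (fun i => w (lshift n i))] `&` E2) (tcat z v)]
    = left_quotient D E by [].
have lE (y x : tup C n) : (fun i => tcat y x (lshift n i)) = y.
  by apply: funext => i; rewrite tcat_lshift.
apply/seteqP; split=> [z [y []]|z [Gz [y [Gy Dy Eyz]]]] /=.
  by rewrite lE => Dy /E2E[Gy Gz Eyz]; split=> //; exists y.
by exists y; split; rewrite /= ?lE//; apply/E2E.
Qed.

Variable kappa : Type.
Hypothesis small_nat : small kappa [set: nat].
Hypothesis satC : saturated C kappa.

(** A point [z] of the closure satisfies [D^-1 E'] for all definable [D] and [E']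
    around [F] and [E]; a common witness [y] exists by compactness over [A] and
    the entries of [z]. *)
Lemma closed_over_left_quotient A E F : small kappa A -> closed_over A E ->
  closed_over A F -> closed_over A (left_quotient F E).
Proof.
move=> sA clE clF z zQ.
have Gz : gset G z by apply: zQ; [exact: definable_gset|move=> x []].
split=> //; pose A' := A `|` range z.
have AA' : A `<=` A' by apply: subsetUl.
have A'z i : A' (z i) by right; exists i.
have sA' : small kappa A'.
  by apply: smallU => //; apply: small_finite => //; exact: finite_image.
pose P := [set X : set (tup C n) * set (tup C n) | [/\ definable_over A X.1,
  definable_over A X.2, F `<=` X.1 & E `<=` X.2]].
pose B (X : set (tup C n) * set (tup C n)) :=
  [set y | [/\ gset G y, X.1 y & X.2 (gmul G y z)]].
have PT D : definable_over A D -> F `<=` D -> P (D, setT).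
  by move=> ? ?; split=> //; exact: definable_overT.
have PT' D : definable_over A D -> E `<=` D -> P (setT, D).
  by move=> ? ?; split=> //; exact: definable_overT.
have [||[D1 D2] [/= AD1 AD2 FD1 ED2]|y yB] := realize_base satC (P := P) (B := B) sA'.
- by exists (setT, setT); apply: PT => //; exact: definable_overT.
- move=> [D1 D2] [D1' D2'] [/= ? ? ? ?] [/= ? ? ? ?].
  exists (D1 `&` D1', D2 `&` D2'); last by move=> y [? [? ?] [? ?]].
  by split=> /=; do ?[exact: definable_overI]; move=> x ?; split; auto.
- have [||_ [y [Gy D1y D2y]]] := zQ (left_quotient D1 D2).
  + exact: definable_over_left_quotient.
  + by move=> x [Gx [y [Gy Fy Eyx]]]; split=> //; exists y; split=> //; auto.
  + by exists y.
have Gy : gset G y.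
  apply: (yB _ (setT, setT)); first exact: definable_gset.
    by apply: PT => //; exact: definable_overT.
  by move=> x [].
exists y; split=> //.
  apply: clF => D AD FD; apply: (yB _ (D, setT)); last by move=> x [].
    exact: definable_over_sub AD.
  exact: PT.
apply: clE => D AD ED.
have [|||//] := yB [set y | gset G y /\ D (gmul G y z)] (setT, D).
- by apply: definable_over_rtranslate => //; exact: definable_over_sub AD.
- exact: PT'.
- by move=> x [].
Qed.

End DefinableGroup.

Section GroupLaws.
Context {T : Type} (G : group_in T).
Local Notation mul := (gmul G).
Local Notation inv := (ginv G).
Local Hint Resolve gmul_in ginv_in gone_in : core.

Lemma gmulKV x y : gset G x -> gset G y -> mul (mul x y) (inv y) = x.
Proof. by move=> Gx Gy; rewrite -gmulA// ?(gmulV Gy).2 ?(gmul1 Gx).2//; auto. Qed.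

Lemma gmulVK x y : gset G x -> gset G y -> mul (mul x (inv y)) y = x.
Proof. by move=> Gx Gy; rewrite -gmulA// ?(gmulV Gy).1 ?(gmul1 Gx).2//; auto. Qed.

Lemma gKmulV x y : gset G x -> gset G y -> mul (inv x) (mul x y) = y.
Proof. by move=> Gx Gy; rewrite gmulA// ?(gmulV Gx).1 ?(gmul1 Gy).1//; auto. Qed.

Lemma gmul_ratio x y z : gset G x -> gset G y -> gset G z ->
  mul (mul (mul x z) (inv (mul y z))) y = x.
Proof.
move=> Gx Gy Gz; rewrite -[LHS](gmulKV _ Gz); last by auto.
by rewrite -[X in mul X _]gmulA ?gmulVK ?gmulKV//; auto.
Qed.

Lemma same_rcosetP (H : set T) (a b : T) : subgroup G H -> gset G a ->
  same_rcoset G H a b <-> exists2 c, H c & mul c a = b.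
Proof.
move=> [HG H1 HM HV] Ga; split=> [[g [Gg [h Hh <-] [h' Hh' <-]]]|[c Hc <-]].
  exists (mul h' (inv h)); first by auto.
  by rewrite -gmulA ?gKmulV//; auto.
exists a; split=> //; last by exists c.
by exists (gone G) => //; rewrite (gmul1 Ga).1.
Qed.

End GroupLaws.

(** * An exhaustive filtration of the subgroup *)

(** [B] is an increasing exhaustion of [H] by symmetric sets containing the
    identity, each of them containing the products of the preceding one. *)
Definition filtration {T : Type} (G : group_in T) (H : set T) (B : nat -> set T) :=
  [/\ (forall x, H x <-> exists m, B m x),
      (forall m, B m (gone G)),
      (forall m x, B m x -> B m (ginv G x)) &
      (forall m x y, B m x -> B m y -> B m.+1 (gmul G x y))].

Section Filtration.
Context {T : Type} (G : group_in T) (H : set T) (B : nat -> set T).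
Hypotheses (sH : subgroup G H) (BH : filtration G H B).

Lemma filtrationS m x : B m x -> H x.
Proof. by case: BH => HB _ _ _ Bx; apply/HB; exists m. Qed.

Lemma filtration_in m x : B m x -> gset G x.
Proof. by case: sH => HG _ _ _ /filtrationS/HG. Qed.

Lemma filtration_le m k x : (m <= k)%N -> B m x -> B k x.
Proof.
case: BH => _ B1 _ BM /subnK <-; elim: (k - m)%N => // j IH /IH Bx.
by rewrite addSn -[x](gmul1 (filtration_in Bx)).1; apply: BM.
Qed.

Lemma filtration_mul m k x y : B m x -> B k y -> B (maxn m k).+1 (gmul G x y).
Proof.
case: BH => _ _ _ BM Bx By; apply: BM; apply: filtration_le; try eassumption.
  by rewrite leq_maxl.
by rewrite leq_maxr.
Qed.

End Filtration.

Section TypeSpaces.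
Context {L : language} {C : structure L}.

Lemma definable_over_bigI (A : set C) (n : nat) (I : choiceType) (X : {fset I})
    (F : I -> set (tup C n)) : (forall i, i \in X -> definable_over A (F i)) ->
  definable_over A (\bigcap_(i in [set` X]) F i).
Proof.
move=> AF; rewrite bigcap_fset big_seq; elim/big_ind: _ => //.
  exact: definable_overT.
by move=> D E; exact: definable_overI.
Qed.

(** Sets of types with definable sets of realizations form a base. *)
Lemma definable_over_nbhs (A : set C) (n : nat) (U : set (type_space A n))
    (a : tup C n) : open U -> U (tp A a) ->
  exists D, [/\ definable_over A D, D a & forall b, D b -> U (tp A b)].
Proof.
move=> [X sX <-] [Y XY Ya]; have [Z ZS ZY] := sX _ XY.
exists [set b | Y (tp A b)]; split=> //; last by move=> b Yb; exists Y.
have := @definable_over_bigI A n _ Z (fun i => [set b | (i : set (type_space A n)) (tp A b)]).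
rewrite -ZY; apply => i /ZS/set_mem[phi _ <-].
by exists phi.
Qed.

Lemma closed_over_types (A : set C) (n : nat) (Z : set (type_space A n)) :
  closed Z -> closed_over A [set a | Z (tp A a)].
Proof.
move=> /closed_openC oZ a aZ; apply: contrapT => NZ.
have [D [AD Da DZ]] := definable_over_nbhs oZ NZ.
have := aZ (~` D) (definable_overC AD); apply=> //.
by move=> b Zb Db; exact: DZ Db Zb.
Qed.

Lemma open_definable (A : set C) (n : nat) (D : set (tup C n)) :
  definable_over A D -> exists2 U : set (type_space A n), open U &
    forall a, U (tp A a) <-> D a.
Proof.
move=> [phi Dphi]; exists (basic_clopen phi); last by move=> a; rewrite Dphi.
exists [set basic_clopen phi]; last by rewrite bigcup_set1.
move=> _ ->; exists (finmap.fset1 (basic_clopen phi)).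
  by move=> i; rewrite finmap.inE => /eqP->; apply/mem_set; exists phi.
apply/seteqP; split=> [p /(_ (basic_clopen phi))|p pp i /=].
  by apply; rewrite /= finmap.inE.
by rewrite finmap.inE => /eqP ->.
Qed.

Variable kappa : Type.
Hypothesis homC : strongly_homogeneous C kappa.
Hypothesis small_nat : small kappa [set: nat].

(** An invariant set is the set of realizations of its types over the empty set,
    by homogeneity. *)
Lemma Fsigma_closed_over (n : nat) (H : set (tup C n)) :
  aut_invariant H -> Fsigma_over0 H ->
  exists F : nat -> set (tup C n), (forall i, closed_over set0 (F i)) /\
    forall x, H x <-> exists i, F i x.
Proof.
move=> autH [Z clZ HZ]; exists (fun i => [set a | Z i (tp set0 a)]); split.
  by move=> i; exact: closed_over_types.
move=> x; split=> [Hx|[i Zx]].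
  have : types_of set0 H (tp set0 x) by exists x.
  by rewrite HZ => -[i _ Zx]; exists i.
have : types_of set0 H (tp set0 x) by rewrite HZ; exists i.
move=> [y Hy /tp_same_type yx].
have [s auts syx] := same_type_automorphism homC small_nat yx.
rewrite -(autH s auts); exists y => //; exact: funext.
Qed.

End TypeSpaces.

Section ClosedFiltration.
Context {L : language} {C : structure L} {n : nat}.
Variables (G : group_in (tup C n)) (kappa : Type).
Hypothesis defG : definable_group G.
Hypothesis small_nat : small kappa [set: nat].
Hypothesis satC : saturated C kappa.
Local Hint Resolve gmul_in ginv_in gone_in : core.

Lemma left_quotient_inv (S : set (tup C n)) x :
  left_quotient G S S x -> left_quotient G S S (ginv G x).
Proof.
move=> [Gx [y [Gy Sy Syx]]]; split; first by auto.
by exists (gmul G y x); rewrite gmulKV//; split=> //; auto.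
Qed.

Lemma left_quotient1 (S : set (tup C n)) x :
  gset G x -> S x -> left_quotient G S S (gone G).
Proof. by move=> Gx Sx; split; [auto|exists x; rewrite (gmul1 Gx).2]. Qed.

Lemma sub_left_quotient (S : set (tup C n)) : S `<=` gset G -> S (gone G) ->
  S `<=` left_quotient G S S.
Proof.
move=> SG S1 x Sx; have Gx := SG _ Sx; split=> //.
by exists (gone G); rewrite (gmul1 Gx).1; split=> //; auto.
Qed.

Lemma left_quotient_subgroup (H S : set (tup C n)) : subgroup G H -> S `<=` H ->
  left_quotient G S S `<=` H.
Proof.
move=> [HG H1 HM HV] SH x [Gx [y [Gy Sy Syx]]].
by rewrite -(gKmulV Gy Gx); apply: HM; auto.
Qed.

(** The levels are [B_(m+1) = S_m^-1 S_m] with [S_m] the union of [B_m] and the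
    [m]th closed piece of [H]; the piece [F i0] containing the identity starts
    the recursion. *)
Lemma closed_filtration (H : set (tup C n)) (F : nat -> set (tup C n)) :
  subgroup G H -> (forall i, closed_over set0 (F i)) ->
  (forall x, H x <-> exists i, F i x) ->
  exists B, filtration G H B /\ forall m, closed_over set0 (B m).
Proof.
move=> sH clF HF; have [HG H1 HM HV] := sH.
have /HF[i0 F1] := H1.
pose B := fix B m := if m is m'.+1 then
  left_quotient G (B m' `|` F m') (B m' `|` F m') else left_quotient G (F i0) (F i0).
have FH i : F i `<=` H by move=> x Fx; apply/HF; exists i.
have BH m : B m `<=` H.
  elim: m => [|m IH]; apply: left_quotient_subgroup => //.
  by move=> x [/IH|/FH].
have B1 m : B m (gone G).
  elim: m => [|m IH]; first by apply: left_quotient1 F1; auto.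
  by apply: (@left_quotient1 _ (gone G)); [auto|left].
have BV m x : B m x -> B m (ginv G x) by case: m => [|m]; exact: left_quotient_inv.
have SB m : B m `|` F m `<=` B m.+1.
  by apply: sub_left_quotient => [x [/BH/HG|/FH/HG]|]; [..|left].
exists B; split; last first.
  have s0 : small kappa (set0 : set C) by exact: small_finite.
  elim=> [|m IH]; apply: (closed_over_left_quotient defG small_nat satC) => //;
    exact: closed_overU.
split=> // [x|m x y Bx By].
  split=> [/HF[i Fx]|[m /BH]//].
  by exists i.+1; apply: SB; right.
have [Gx Gy] := (HG _ (BH _ _ Bx), HG _ (BH _ _ By)).
split; first by auto.
exists (ginv G x); rewrite gKmulV//; split; [auto|left; exact: BV|by left].
Qed.

End ClosedFiltration.

(** * A minimal closed invariant set and its thin classes *)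

Section Minimal.
Context {L : language} {C : structure L} {n : nat}.
Variables (G : group_in (tup C n)) (kappa : Type).
Hypothesis defG : definable_group G.
Hypothesis small_nat : small kappa [set: nat].
Hypothesis satC : saturated C kappa.
Variables (H K : set (tup C n)) (B : nat -> set (tup C n)) (M : set C).
Hypothesis sH : subgroup G H.
Hypothesis BH : filtration G H B.
Hypothesis clB : forall m, closed_over M (B m).
Hypothesis sM : small kappa M.

(** The tuples with entries in [M]. *)
Definition in_model (x : tup C n) : Prop := forall i, M (x i).

Hypothesis M1 : in_model (gone G).
Hypothesis MM : forall x y, in_model x -> in_model y -> in_model (gmul G x y).
Hypothesis Mrep : forall a, gset G a ->
  exists r, [/\ gset G r, in_model r & H (gmul G a r)].
Hypothesis Mout : forall m, exists h, [/\ H h, in_model h & ~ B m h].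
Hypothesis sK : subgroup G K.
Hypothesis HK : H `<=` K.
Hypothesis clK : closed_over M K.
Local Hint Resolve gmul_in ginv_in gone_in : core.

Let HG x : H x -> gset G x. Proof. by case: sH => HG _ _ _; exact: HG. Qed.
Let KG x : K x -> gset G x. Proof. by case: sK => KG _ _ _; exact: KG. Qed.
Let HMul x y : H x -> H y -> H (gmul G x y).
Proof. by case: sH => _ _ HM _; exact: HM. Qed.
Let H1 : H (gone G). Proof. by case: sH. Qed.

(** Nonempty closed subsets of [K] invariant under left multiplication by the
    elements of [H] with entries in [M]. *)
Definition invariant_closed (F : set (tup C n)) : Prop :=
  [/\ closed_over M F, F `<=` K, F !=set0 &
    forall h x, H h -> in_model h -> F x -> F (gmul G h x)].

Lemma ex_minimal_invariant_closed : exists Y, invariant_closed Y /\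
  forall F, invariant_closed F -> F `<=` Y -> Y `<=` F.
Proof.
have [X [PX maxX]] : exists X, invariant_closed (K `\` X) /\
    forall X', X `<` X' -> ~ invariant_closed (K `\` X').
  apply: (@Zorn_bigcup _ (fun X => invariant_closed (K `\` X))) => F FP tF.
  have KP : invariant_closed K.
    split=> //; first by exists (gone G); case: sK.
    by move=> h x Hh _ Kx; case: sK => _ _ KM _; apply: KM => //; exact: HK.
  (* the empty set is added so that the empty chain is covered *)
  pose F' X := F X \/ X = set0.
  have F'P X : F' X -> invariant_closed (K `\` X).
    by move=> [/FP//|->]; rewrite setD0.
  have KF' a : (K `\` \bigcup_(X in F) X) a <-> forall X, F' X -> (K `\` X) a.
    split=> [[Ka Na] X [FX|->]|KX]; last 1 first.
    - split; first by have [] := KX set0 (or_intror erefl).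
      by move=> [X FX Xa]; have [] := KX X (or_introl FX).
    - by split=> // Xa; apply: Na; exists X.
    - by split=> // -[].
  split.
  - move=> a aF; apply/KF' => X F'X; have [clX _ _ _] := F'P _ F'X.
    by apply: clX => D MD XD; apply: aF => // b /KF' /(_ X F'X); exact: XD.
  - by move=> a [].
  - pose P D := definable_over M D /\ exists2 X, F' X & K `\` X `<=` D.
    have [||D [MD [X F'X XD]]|a aP] :=
        realize_base satC (P := P) (B := fun D => D) sM.
    + exists setT; split; first exact: definable_overT.
      by exists set0; [right|].
    + move=> D D' [MD [X F'X XD]] [MD' [X' F'X' XD']]; exists (D `&` D') => //.
      split; first exact: definable_overI.
      have [XX'|X'X] : X `<=` X' \/ X' `<=` X.
        move: F'X F'X' => [FX|->] [FX'|->]; try (by right); try by left.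
        exact: tF.
      * by exists X' => // x [Kx Nx]; split; [apply: XD; split=> // /XX'|exact: XD'].
      * by exists X => // x [Kx Nx]; split; [exact: XD|apply: XD'; split=> // /X'X].
    + by have [_ _ [a Xa] _] := F'P _ F'X; exists a; exact: XD.
    + exists a; apply/KF' => X F'X; have [clX _ _ _] := F'P _ F'X.
      apply: clX => D MD XD; apply: (aP D D) => //.
      by split=> //; exists X.
  - move=> h x Hh Mh /KF' xF; apply/KF' => X F'X.
    by have [_ _ _ iX] := F'P _ F'X; apply: iX => //; exact: xF.
exists (K `\` X); split=> // F [clF FK F0 iF] FX x KXx; apply: contrapT => NFx.
apply: (maxX (X `|` (K `\` F))).
  split; first by apply: subsetUl.
  by move=> XX; apply: KXx.2; apply: XX; right; split=> //; case: KXx.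
suff -> : K `\` (X `|` (K `\` F)) = F by [].
apply/seteqP; split=> y.
  by move=> [Ky Ny]; apply: contrapT => NFy; apply: Ny; right.
move=> Fy; have [Ky NXy] := FX _ Fy; split=> // -[//|[_ NFy]].
exact: NFy.
Qed.

Variable Y : set (tup C n).
Hypothesis iY : invariant_closed Y.
Hypothesis minY : forall F, invariant_closed F -> F `<=` Y -> Y `<=` F.

Let YG x : Y x -> gset G x. Proof. by case: iY => _ YK _ _ /YK/KG. Qed.

(** The points of [Y] adherent to the orbit of [a] form a closed invariant set. *)
Lemma orbit_dense (a b : tup C n) (D : set (tup C n)) :
  Y a -> Y b -> definable_over M D -> D b ->
  exists h, [/\ H h, in_model h & D (gmul G h a)].
Proof.
move=> Ya Yb MD Db; have [clY YK _ invY] := iY.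
pose Z := [set x | Y x /\ forall D, definable_over M D -> D x ->
  exists h, [/\ H h, in_model h & D (gmul G h a)]].
suff /minY/(_ _)/(_ b Yb) : invariant_closed Z.
  by move=> YZ; have [|_] := YZ; [move=> x []|apply].
split.
- move=> x xZ; split.
    by apply: clY => E ME YE; apply: xZ => // y [/YE].
  move=> E ME Ex; apply: contrapT => NE.
  apply: (xZ (~` E) (definable_overC ME) _ Ex) => y [_ /(_ E ME) yE] Ey.
  exact/NE/yE.
- by move=> x [/YK].
- by exists a; split=> // E ME Ea; exists (gone G); rewrite (gmul1 (YG Ya)).1.
- move=> h x Hh Mh [Yx xZ]; split; first exact: invY.
  move=> E ME Ehx.
  have [||h' [Hh' Mh' [_ Eh]]] := xZ [set u | gset G u /\ E (gmul G h u)].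
  + by apply: definable_over_ltranslate => //; exact: HG.
  + by split=> //; exact: YG.
  by exists (gmul G h h'); split; [exact: HMul|exact: MM|rewrite -gmulA//; auto].
Qed.

(** The sets [B m r^-1] have empty interior in [Y]. If one of them contained the
    trace on [Y] of a definable set, then, by compactness, translates of that
    set by elements of a single [B k] would cover [Y], so [Y] would lie in some
    [B k' r^-1] and all the elements of [H] in the model would lie in
    [B k'.+1]. *)
Lemma thin_classes (m : nat) (r : tup C n) (D : set (tup C n)) (b : tup C n) :
  gset G r -> in_model r -> definable_over M D -> Y b -> D b ->
  exists y, [/\ Y y, D y & ~ B m (gmul G y r)].
Proof.
move=> Gr Mr MD Yb Db; apply: contrapT => noy.
have inB y : Y y -> D y -> B m (gmul G y r).
  by move=> Yy Dy; apply: contrapT => NB; apply: noy; exists y.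
have [clY YK _ invY] := iY; have [HB B1 BV BM] := BH.
pose U k := [set y | Y y /\ forall h, in_model h -> B k h -> ~ D (gmul G h y)].
have [k Uk] : exists k, ~ (U k !=set0).
  apply/existsNP => U0.
  have [||y yU] := realize_base satC (P := setT) (B := U) sM _ _ (fun i _ => U0 i).
  - by exists 0%N.
  - move=> i j _ _; exists (maxn i j) => // y [Yy yU]; split; split=> // h Mh Bh;
      apply: yU => //; apply: (filtration_le sH BH) Bh;
      by rewrite ?leq_maxl ?leq_maxr.
  have Yy : Y y by apply: clY => E ME YE; apply: (yU E 0%N) => // x [/YE].
  have [h [/[dup] Hh /HB[k Bh] Mh Dhy]] := orbit_dense Yy Yb MD Db.
  have [||x [Yx xU]|_ []//] := yU [set u | gset G u /\ (~` D) (gmul G h u)] k.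
  - by apply: definable_over_ltranslate => //; [exact: HG|exact: definable_overC].
  - by [].
  - by split; [exact: YG|exact: xU].
pose k' := (maxn k m).+1.
have YB y : Y y -> B k' (gmul G y r).
  move=> Yy; have [h [Mh Bh Dhy]] : exists h, [/\ in_model h, B k h & D (gmul G h y)].
    apply: contrapT => noh; apply: Uk; exists y; split=> // h Mh Bh Dhy.
    by apply: noh; exists h.
  have Gh := filtration_in sH BH Bh; have Gy := YG Yy.
  have Hh : H h by apply/HB; exists k.
  have := filtration_mul sH BH (BV _ _ Bh) (inB _ (invY _ _ Hh Mh Yy) Dhy).
  by rewrite -gmulA ?gKmulV//; auto.
have [h [Hh Mh]] := Mout k'.+1; apply.
have Gb := YG Yb; have Gh := HG Hh.
rewrite -(gmulKV (y := gmul G b r) Gh); last by auto.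
by apply: BM; [rewrite gmulA//; exact/YB/invY|exact/BV/YB].
Qed.

(** The translate [g D'] avoids the points [b x] with [b] in [B N] and [x] in
    [D']: the element [g] is chosen with [g a] outside [B k r^-1], where
    [a r] is in [B j] and [k] exceeds [N] and [j]. *)
Lemma splitting_step (a : tup C n) (D : set (tup C n)) (N : nat) :
  Y a -> definable_over M D -> D a -> D `<=` gset G ->
  exists g D', [/\ H g, in_model g, definable_over M D', D' a &
    [/\ D' `<=` D, forall x, D' x -> D (gmul G g x) &
      forall b x y, B N b -> D' x -> D' y -> gmul G b x <> gmul G g y]].
Proof.
move=> Ya MD Da DG; have Ga := YG Ya; have [HB B1 BV BM] := BH.
have [r [Gr Mr /HB[j Bar]]] := Mrep Ga.
pose k := (maxn N j).+1.
have [y [Yy Dy NBy]] := thin_classes k Gr Mr MD Ya Da.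
have [E [ME Ey EB]] : exists E, [/\ definable_over M E, E y &
    forall x, E x -> ~ (gset G x /\ B k (gmul G x r))].
  apply: (closed_over_separated (F := [set x | gset G x /\ B k (gmul G x r)])).
    exact: closed_over_rtranslate.
  by case.
have [g [Hg Mg [Dga Ega]]] := orbit_dense Ya Yy (definable_overI MD ME) (conj Dy Ey).
have Gg := HG Hg; have MDE := definable_overI MD ME.
have [D1 [MD1 D1a D1Q]] : exists D1, [/\ definable_over M D1, D1 a &
    forall x, D1 x -> ~ left_quotient G (B N) (D `&` E) x].
  apply: (closed_over_separated (F := left_quotient G (B N) (D `&` E))).
    apply: (closed_over_left_quotient defG small_nat satC) => //.
    exact: closed_over_definable.
  move=> [_ [b [Gb Bb [_ /EB]]]]; apply; split; first by auto.
  by rewrite -gmulA//; exact: (filtration_mul sH BH).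
exists g, (D `&` D1 `&` [set x | gset G x /\ (D `&` E) (gmul G g x)]); split=> //.
- apply: definable_overI; first exact: definable_overI.
  exact: definable_over_ltranslate.
split=> [x [[]]//|x [_ [_ []]]//|b x z Bb [[Dx D1x] _] [_ [_ DEz]] e].
apply: (D1Q _ D1x); split; first exact: DG.
by exists b; rewrite e; split=> //; exact: (filtration_in sH BH Bb).
Qed.

End Minimal.

(** * A Cantor scheme *)

Section Scheme.
Context {L : language} {C : structure L} {n : nat}.
Variables (G : group_in (tup C n)) (kappa : Type).
Hypothesis defG : definable_group G.
Hypothesis satC : saturated C kappa.
Variables (H K : set (tup C n)) (B : nat -> set (tup C n)) (M : set C).
Hypothesis sH : subgroup G H.
Hypothesis BH : filtration G H B.
Hypothesis sM : small kappa M.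
Hypothesis M1 : in_model M (gone G).
Hypothesis MM : forall x y, in_model M x -> in_model M y -> in_model M (gmul G x y).
Hypothesis sK : subgroup G K.
Hypothesis HK : H `<=` K.
Hypothesis clK : closed_over M K.
Local Hint Resolve gmul_in ginv_in gone_in : core.

Let HG x : H x -> gset G x. Proof. by case: sH => HG _ _ _; exact: HG. Qed.
Let KG x : K x -> gset G x. Proof. by case: sK => KG _ _ _; exact: KG. Qed.
Let HMul x y : H x -> H y -> H (gmul G x y).
Proof. by case: sH => _ _ HM _; exact: HM. Qed.
Let H1 : H (gone G). Proof. by case: sH. Qed.
Let HV x : H x -> H (ginv G x). Proof. by case: sH => _ _ _ HV; exact: HV. Qed.

Variable a : tup C n.
Hypothesis Ka : K a.
Hypothesis step : forall (D : set (tup C n)) (N : nat),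
  definable_over M D -> D a -> D `<=` gset G ->
  exists g D', [/\ H g, in_model M g, definable_over M D', D' a &
    [/\ D' `<=` D, forall x, D' x -> D (gmul G g x) &
      forall b x y, B N b -> D' x -> D' y -> gmul G b x <> gmul G g y]].

(** The definable neighbourhoods [D] of [a] on which the scheme is built. *)
Definition scheme_nbhs (D : set (tup C n)) : Prop :=
  [/\ definable_over M D, D a & D `<=` gset G].

(** A Cantor scheme at [a]: the 2^m sets [c D_m], with [c] a product of some of
    [g_0, ..., g_(m-1)] in increasing order, are the pieces of stage [m]. The
    number [k m] bounds the level in the filtration of all these products [c];
    the last clause separates any two pieces of stage [m.+1] that differ in their
    last choice by the level [m] of the filtration. *)
Definition cantor_scheme (g : nat -> tup C n) (D : nat -> set (tup C n))
    (k : nat -> nat) : Prop :=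
  forall m, [/\ scheme_nbhs (D m), H (g m) /\ in_model M (g m),
    D m.+1 `<=` D m /\ (forall x, D m.+1 x -> D m (gmul G (g m) x)),
    forall c, B (k m) c -> B (k m.+1) c /\ B (k m.+1) (gmul G c (g m)) &
    forall c d b x y, B (k m) c -> B (k m) d -> B m b -> D m.+1 x -> D m.+1 y ->
      gmul G b (gmul G c x) <> gmul G d (gmul G (g m) y)].

Lemma ex_scheme : exists g D k, cantor_scheme g D k.
Proof.
have [HB B1 BV BM] := BH.
pose next (s : nat * (set (tup C n) * nat)) (t : tup C n * (set (tup C n) * nat)) :=
  let: (m, (D, k)) := s in let: (g, (D', k')) := t in scheme_nbhs D ->
  [/\ scheme_nbhs D', H g /\ in_model M g,
    D' `<=` D /\ (forall x, D' x -> D (gmul G g x)),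
    forall c, B k c -> B k' c /\ B k' (gmul G c g) &
    forall c d b x y, B k c -> B k d -> B m b -> D' x -> D' y ->
      gmul G b (gmul G c x) <> gmul G d (gmul G g y)].
have [f nextf] : exists f, forall s, next s (f s).
  apply: ex_choice => -[m [D k]].
  have [[MD Da DG]|ND] := pselect (scheme_nbhs D); last by exists (a, (D, k)).
  have [g [D' [Hg Mg MD' D'a [D'D gD' sepD']]]] :=
    (* a level that contains d^-1 b c, for b of level m and c, d of level k *)
    step (maxn k (maxn m k).+1).+1 MD Da DG.
  have /HB[j Bg] := Hg; exists (g, (D', (maxn k j).+1)) => _; split=> //.
  - by split=> // x /D'D/DG.
  - move=> c Bc; split; last exact: (filtration_mul sH BH).
    by apply: (filtration_le sH BH) Bc; rewrite leqW// leq_maxl.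
  - move=> c d b x y Bc Bd Bb D'x D'y e.
    have [Gc Gd Gb] : [/\ gset G c, gset G d & gset G b].
      by split; apply: (filtration_in sH BH); eassumption.
    have [Gx Gy Gg] := And3 (DG _ (D'D _ D'x)) (DG _ (D'D _ D'y)) (HG Hg).
    apply: (sepD' (gmul G (ginv G d) (gmul G b c)) x y _ D'x D'y).
      exact: (filtration_mul sH BH (BV _ _ Bd) (filtration_mul sH BH Bb Bc)).
    by rewrite -!gmulA ?e ?gKmulV//; auto.
pose s := fix s m := if m is m'.+1 then (f (m', s m')).2 else (gset G, 0%N).
exists (fun m => (f (m, s m)).1), (fun m => (s m).1), (fun m => (s m).2).
have nbhss m : scheme_nbhs (s m).1.
  elim: m => [|m IH] /=.
    by split=> //; [exact: definable_gset|exact: KG].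
  have := nextf (m, s m); case: (s m) IH => D k /= nD.
  by case: (f _) => g [D' k'] /(_ nD)[].
move=> m; have := nextf (m, s m); have := nbhss m; rewrite /=.
case: (s m) => D k /= nD.
by case: (f _) => g [D' k'] /= /(_ nD)[nD' Hg DD' Bk sep]; split.
Qed.

Section Points.
Variables (g : nat -> tup C n) (D : nat -> set (tup C n)) (k : nat -> nat).
Hypothesis scheme : cantor_scheme g D k.

Implicit Types eta : nat -> bool.

(** The product of the [g i], [i < m], with [eta i] true, in increasing order. *)
Fixpoint branch eta (m : nat) : tup C n :=
  if m is m'.+1 then gmul G (branch eta m') (if eta m' then g m' else gone G)
  else gone G.

(** The pieces of stage [m] are translates of [D m] by elements of [H]. *)
Definition piece eta m : set (tup C n) := [set gmul G (branch eta m) y | y in D m].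

(** The points of [K] in all the pieces along [eta]. *)
Definition branch_set eta : set (tup C n) :=
  [set x | K x /\ forall m, piece eta m x].

Let DG m x : D m x -> gset G x.
Proof. by have [[_ _ DG] _ _ _ _] := scheme m; exact: DG. Qed.

Lemma branch_in eta m : H (branch eta m) /\ in_model M (branch eta m).
Proof.
elim: m => [|m [Hb Mb]] //=; have [_ [Hg Mg] _ _ _] := scheme m.
by case: ifP => _; split; do ?[exact: HMul|exact: MM].
Qed.

Let GB eta m : gset G (branch eta m). Proof. by have [/HG] := branch_in eta m. Qed.

Lemma branch_level eta m : B (k m) (branch eta m).
Proof.
elim: m => [|m IH] /=; first by case: BH.
have [_ _ _ Bk _] := scheme m; have [B0 B1] := Bk _ IH.
by case: ifP => _ //; rewrite (gmul1 (GB _ _)).2.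
Qed.

Lemma branch_eq eta eta' m :
  (forall i, (i < m)%N -> eta i = eta' i) -> branch eta m = branch eta' m.
Proof.
elim: m => [|m IH] //= e; rewrite IH ?e// => i im.
by apply: e; exact: ltnW.
Qed.

Lemma pieceS eta m x : piece eta m.+1 x -> piece eta m x.
Proof.
move=> [y Dy <-] /=; have [_ [/HG Gg _] [D'D gD'] _ _] := scheme m.
have Gy := DG Dy; case: ifP => _.
  by exists (gmul G (g m) y); [exact: gD'|rewrite gmulA].
by exists y; [exact: D'D|rewrite (gmul1 (GB _ _)).2].
Qed.

Lemma piece_le eta m j x : (m <= j)%N -> piece eta j x -> piece eta m x.
Proof. by move=> /subnK <-; elim: (j - m)%N => // i IH /pieceS. Qed.

Lemma piece_definable eta m : definable_over M (piece eta m).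
Proof.
have [[MD _ _] _ _ _ _] := scheme m; have [Hb Mb] := branch_in eta m.
by apply: (definable_over_image defG Mb (HG Hb) MD) => x; exact: DG.
Qed.

Lemma piece_separated eta eta' m b x x' : eta m <> eta' m -> B m b ->
  piece eta m.+1 x -> piece eta' m.+1 x' -> gmul G b x <> x'.
Proof.
have sep e e' c y y' : e m = false -> e' m = true -> B m c ->
    piece e m.+1 y -> piece e' m.+1 y' -> gmul G c y <> y'.
  move=> em em' Bc [z Dz <-] [z' Dz' <-] /=; rewrite em em' (gmul1 (GB _ _)).2.
  have [_ [/HG Gg _] _ _ sep] := scheme m.
  by rewrite -(gmulA (GB _ _) Gg (DG Dz')); apply: sep => //; exact: branch_level.
move=> ee' Bb px px' e.
case em: (eta m) ee'; case em': (eta' m) => // _.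
  apply: (sep _ _ (ginv G b) x' x em' em) => //; first by case: BH => _ _ BV _; exact: BV.
  have Gb := filtration_in sH BH Bb.
  have Gx : gset G x by case: px => y /DG Gy <-; auto.
  by rewrite -e gKmulV.
exact: (sep _ _ b x x' em em' Bb px px' e).
Qed.

Lemma branch_set_closed eta : closed_over M (branch_set eta).
Proof.
apply: closed_overI => //; apply: (closed_over_bigI (F := piece eta)) => m.
by apply: closed_over_definable; exact: piece_definable.
Qed.

(** A closed set meeting all the pieces of a branch meets their intersection. *)
Lemma branch_set_compact eta (F : set (tup C n)) : closed_over M F ->
  F `<=` K -> (forall m, exists2 x, F x & piece eta m x) ->
  exists2 x, F x & branch_set eta x.
Proof.
move=> clF FK F0.
have [|i j _ _|m _|x xF] := realize_base satC (P := setT)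
  (B := fun m => F `&` piece eta m) sM.
- by exists 0%N.
- exists (maxn i j) => // y [Fy py]; split; split=> //; apply: piece_le py;
    by rewrite ?leq_maxl ?leq_maxr.
- by have [x Fx px] := F0 m; exists x.
have Fx : F x by apply: clF => E ME FE; apply: (xF E 0%N) => // y [/FE].
exists x => //; split; first exact: FK.
by move=> m; apply: (xF _ m (piece_definable eta m)).
Qed.

Lemma branch_set_nonempty eta : branch_set eta !=set0.
Proof.
suff [x _ bx] : exists2 x, K x & branch_set eta x by exists x.
apply: branch_set_compact => // m.
have [[_ Da _] _ _ _ _] := scheme m; have [Hb _] := branch_in eta m.
exists (gmul G (branch eta m) a); last by exists a.
by case: sK => _ _ KM _; apply: KM => //; exact: HK.
Qed.

(** Branches with a common tail are translates of each other by elements of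
    [H]. *)
Lemma branch_set_tail eta eta' m x : (forall i, (m <= i)%N -> eta i = eta' i) ->
  branch_set eta x -> exists2 c, H c & branch_set eta' (gmul G c x).
Proof.
move=> ee' [Kx px].
pose c := gmul G (branch eta' m) (ginv G (branch eta m)).
have Hc : H c by apply: HMul; [|apply: HV]; exact: (branch_in _ _).1.
have Gc := HG Hc.
have cb j : gmul G c (branch eta (j + m)) = branch eta' (j + m).
  elim: j => [|j IH] /=; first by rewrite gmulVK.
  rewrite -ee' ?leq_addl// -IH gmulA//; case: ifP => _; last by auto.
  by have [_ [/HG]] := scheme (j + m).
exists c => //; split; first by case: sK => _ _ KM _; apply: KM => //; exact: HK.
move=> i; apply: (@piece_le _ _ (i + m)); first exact: leq_addr.
have [y Dy <-] := px (i + m)%N; exists y => //.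
by rewrite gmulA ?cb//; exact: DG Dy.
Qed.

(** The points of the branch [eta'] lie in only one piece of each stage. *)
Lemma piece_prefix eta eta' m x : branch_set eta' x -> piece eta m x ->
  forall i, (i < m)%N -> eta' i = eta i.
Proof.
move=> [Kx px] pm i im; apply: contrapT => ne.
have Gx := KG Kx.
have := piece_separated (b := gone G) ne _ (px i.+1) (piece_le im pm).
by rewrite (gmul1 Gx).1; apply=> //; case: BH.
Qed.

End Points.
End Scheme.

(** * Topology of the Cantor space and of the sub-Vietoris hyperspace *)

(** The basic clopen set of the sequences agreeing with [eta] below [m]. *)
Definition cylinder (eta : cantor_space) (m : nat) : set cantor_space :=
  [set eta' | forall i, (i < m)%N -> eta' i = eta i].

Lemma cylinder_nbhs (eta : cantor_space) (m : nat) : nbhs eta (cylinder eta m).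
Proof.
elim: m => [|m IH]; first by apply: filterS filterT => eta' _ i.
have near_m : nbhs eta [set eta' : cantor_space | eta' m = eta m].
  have /(_ [set eta m]) := @proj_continuous nat (fun=> bool) m eta.
  by apply; exact: discrete_set1.
apply: filterS (filterI IH near_m) => eta' [em e] i.
by rewrite ltnS leq_eqVlt => /orP[/eqP->//|/em].
Qed.

Lemma cylinder_base (eta : cantor_space) (U : set cantor_space) :
  open U -> U eta -> exists m, cylinder eta m `<=` U.
Proof.
move=> oU Ueta; pose F := filter_from [set: nat] (cylinder eta).
have FF : Filter F.
  apply: filter_from_filter; first by exists 0%N.
  move=> i j _ _; exists (maxn i j) => // eta' e.
  by split=> l li; apply: e; apply: leq_trans li _; rewrite ?leq_maxl ?leq_maxr.
suff Feta : F --> eta.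
  by have [m _ mU] := Feta _ (open_nbhs_nbhs (conj oU Ueta)); exists m.
apply/cvg_sup => i A /= [_ [[W oW <-] Weta WA]]; exists i.+1 => // eta' e.
by apply: WA; rewrite /= /proj e.
Qed.

Lemma open_avoiding (Z : topologicalType) (W : set Z) :
  closed W -> open (avoiding W : set (sub_vietoris Z)).
Proof.
move=> clW; exists [set avoiding W]; last by rewrite bigcup_set1.
move=> _ ->; exists (finmap.fset1 W).
  by move=> i; rewrite finmap.inE => /eqP->; exact/mem_set.
apply/seteqP; split=> [A /(_ W)|A AW i /=].
  by apply; rewrite /= finmap.inE.
by rewrite finmap.inE => /eqP ->.
Qed.

(** Continuity is tested on the subbasic sets of the sub-Vietoris topology. *)
Lemma continuous_sub_vietoris (X Z : topologicalType) (f : X -> sub_vietoris Z) :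
  (forall x W, closed W -> f x `&` W = set0 ->
     \forall y \near x, f y `&` W = set0) -> continuous f.
Proof.
move=> fP x A /=; rewrite nbhsE => -[_ [[S sS <-] [U SU Ux]] UA].
rewrite nbhs_filterE; apply: filterS UA _; apply: (@filterS _ _ _ U).
  by move=> y Uy; exists U.
have /sS [D sD IDeU] := SU; rewrite -IDeU; apply: filter_bigI => W DW.
apply: fP; first exact: (set_mem (sD _ DW)).
by move: Ux; rewrite -IDeU => /(_ _ DW).
Qed.

(** * The model *)

Section Model.
Context {L : language} {C : structure L}.

Lemma small_prod (kappa T U : Type) : small kappa [set: nat] ->
  small kappa [set: T] -> small kappa [set: U] -> small kappa [set: T * U].
Proof.
move=> sN sT sU.
have [V1 [sV1 nV1 _ [t ti]]] := small_bound2 sN sT (ex_intro _ id (fun x y => id)).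
have [V [sV nV [v vi] [u ui]]] := small_bound2 sV1 sU nV1.
have [p pi] := injects_square nV.
apply: small_card_le sV; apply/card_leT_injects.
exists (fun x => p (v (t x.1), u x.2)) => -[x y] [x' y'] /pi[] /vi/ti -> /ui ->.
by [].
Qed.

Lemma small_range (kappa T U : Type) (f : T -> U) :
  small kappa [set: T] -> small kappa (range f).
Proof. exact: small_card_le (card_image_le _ _). Qed.

Lemma small_ord (kappa : Type) (m : nat) :
  small kappa [set: nat] -> small kappa [set: 'I_m].
Proof.
by apply: small_card_le; apply/card_leT_injects; exists val; exact: val_inj.
Qed.

(** The parameters added to those of [K] are the entries of the identity, of the
    inverses of coset representatives and of elements of [H] outside each
    [B m]; the coordinates of multiplication are taken as operations. *)
Lemma ex_model (kappa : Type) (n : nat) (G : group_in (tup C n))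
    (H K : set (tup C n)) (B : nat -> set (tup C n)) :
  monster C kappa -> subgroup G H -> bounded_index G kappa H ->
  filtration G H B -> (forall m, closed_over set0 (B m)) ->
  pseudo_closed kappa K -> ~ type_definable H ->
  exists M : set C, [/\ elementary_substructure M, small kappa M, closed_over M K,
    in_model M (gone G) /\
    (forall x y, in_model M x -> in_model M y -> in_model M (gmul G x y)) &
    (forall a, gset G a -> exists r, [/\ gset G r, in_model M r & H (gmul G a r)]) /\
    (forall m, exists h, [/\ H h, in_model M h & ~ B m h])].
Proof.
move=> [sN sL infC _ _] sH bH BH clB [A sA AK] NH; have [HG H1 HM HV] := sH.
have [x0 _] : [set: C] !=set0.
  by apply/set0P/eqP => C0; apply: infC; rewrite C0; exact: finite_set0.
have /ex_choice[h Hh] m : exists h, H h /\ ~ B m h.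
  apply: contrapT => /forallNP noh; apply: NH.
  apply/closed_over_type_definable; suff -> : H = B m by exact: clB.
  apply/seteqP; split=> x; last exact: (filtrationS BH).
  by move=> Hx; apply: contrapT => NBx; apply: (noh x).
pose Q := [set rcoset_of G H g | g in gset G].
have /ex_choice[rep Hrep] (X : set_type Q) :
    exists g, gset G g /\ rcoset_of G H g = val X.
  by have [g Gg gX] := set_valP X; exists g.
pose S := (A `|` range (gone G)) `|`
  (range (fun p : nat * 'I_n => h p.1 p.2) `|`
   range (fun p : set_type Q * 'I_n => ginv G (rep p.1) p.2)).
have sS : small kappa S.
  apply: smallU => //; apply: smallU => //; apply: small_range.
  - exact: small_ord.
  - by apply: small_prod => //; exact: small_ord.
  - by apply: small_prod => //; [exact: small_set_type|exact: small_ord].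
pose op (i : 'I_n) (w : 'I_(n + n) -> C) : C :=
  gmul G (fun j => w (lshift n j)) (fun j => w (rshift n j)) i.
have [M [eM sM SM opM]] := loewenheim_skolem x0 op sN sL (small_ord n sN) sS.
exists M; split=> //.
- apply: closed_over_sub (_ : closed_over A K); last exact/closed_over_type_definable.
  by move=> x Ax; apply: SM; left; left.
- split=> [i|x y Mx My i]; first by apply: SM; left; right; exists i.
  have := opM i (tcat x y); rewrite /op.
  have -> : (fun j => tcat x y (lshift n j)) = x.
    by apply: funext => j; rewrite tcat_lshift.
  have -> : (fun j => tcat x y (rshift n j)) = y.
    by apply: funext => j; rewrite tcat_rshift.
  apply=> j; rewrite -(splitK j); case: (fintype.split j) => l /=.
    by rewrite tcat_lshift.
  by rewrite tcat_rshift.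
- split=> [a Ga|m].
    have Qa : Q (rcoset_of G H a) by exists a.
    pose X : set_type Q := exist (fun X => X \in Q) _ (mem_set Qa).
    have [Gr rX] := Hrep X; exists (ginv G (rep X)); split.
    + exact: ginv_in.
    + by move=> i; apply: SM; right; right; exists (X, i).
    + have : rcoset_of G H (rep X) a.
        by rewrite rX; exists (gone G) => //; rewrite (gmul1 Ga).1.
      by move=> [g Hg <-]; rewrite gmulKV//; exact: HG.
  exists (h m); have [? ?] := Hh m; split=> // i.
  by apply: SM; right; left; exists (m, i).
Qed.

End Model.

(** * The embedding *)

Section Embedding.
Context {L : language} {C : structure L} {n : nat}.
Variables (M : set C) (K : set (tup C n)).
Local Notation KM := (set_type (types_of M K)).

(** The types over [M] of the elements of [D], as points of [K_M]. *)
Definition types_in (D : set (tup C n)) : set KM :=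
  [set p | exists2 x, D x & tp M x = val p].

(** Membership of a type does not depend on its realization. *)
Lemma types_inP (D : set (tup C n)) (p : KM) (x : tup C n) : closed_over M D ->
  tp M x = val p -> types_in D p <-> D x.
Proof.
move=> clD xp; split=> [[y Dy yp]|Dx]; last by exists x.
by apply: (closed_over_same_type clD _ Dy); apply/tp_same_type; rewrite yp.
Qed.

Lemma types_realized (p : KM) : exists2 x, K x & tp M x = val p.
Proof. exact: (set_valP p). Qed.

Lemma open_types_in (D : set (tup C n)) : definable_over M D -> open (types_in D).
Proof.
move=> MD; have [U oU UD] := open_definable MD; exists U => //.
apply/seteqP; split=> p; have [x _ xp] := types_realized p => /=.
  by rewrite /set_val/= -xp UD; exists x.
by move=> [y Dy yp]; rewrite /set_val/= -yp UD.
Qed.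

Lemma closed_types_in (D : set (tup C n)) : definable_over M D -> closed (types_in D).
Proof.
move=> MD; rewrite -[types_in D]setCK; apply: open_closedC.
suff -> : ~` types_in D = types_in (~` D) by exact/open_types_in/definable_overC.
apply/seteqP; split=> p /=; have [x _ xp] := types_realized p.
  rewrite (types_inP (closed_over_definable MD) xp) => NDx.
  by exists x.
move=> [y NDy yp]; rewrite (types_inP (closed_over_definable MD) yp).
exact.
Qed.

(** The realizations of a closed subset of [K_M] form a closed set of tuples. *)
Lemma closed_over_types_realized (W : set KM) : closed_over M K -> closed W ->
  closed_over M [set x | K x /\ exists2 p, W p & tp M x = val p].
Proof.
move=> clK /closed_openC[U oU UW].
have -> : [set x | K x /\ exists2 p, W p & tp M x = val p] =
    K `&` [set x | (~` U) (tp M x)].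
  apply/seteqP; split=> x [Kx].
    by move=> [p Wp xp]; split=> //= Ux; have : (~` W) p by rewrite -UW /= /set_val/= -xp.
  move=> NUx; split=> //.
  have Kp : types_of M K (tp M x) by exists x.
  exists (exist (fun p => p \in types_of M K) _ (mem_set Kp)) => //.
  by apply: contrapT => NWp; apply: NUx; move: NWp; rewrite -[~ _]/((~` W) _) -UW.
by apply: closed_overI => //; apply: closed_over_types; exact: open_closedC.
Qed.

End Embedding.

Theorem corollary3p11 (L : language) (C : structure L) (kappa : Type)
    (n : nat) (G : group_in (tup C n)) (H K : set (tup C n)) :
  monster C kappa ->
  definable_group G ->
  normal_subgroup G H ->
  bounded_index G kappa H ->
  aut_invariant H ->
  Fsigma_over0 H ->
  subgroup G K ->
  H `<=` K ->
  pseudo_closed kappa K ->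
  ~ type_definable H ->
  exists M : set C,
    [/\ elementary_substructure M, small kappa M &
    (* The points of phi eta are elements of the subspace K_M of S_n(M), and
       "closed" and "G_delta" are relative to K_M. *)
    exists phi : cantor_space -> sub_vietoris (set_type (types_of M K)),
      let sat_phi eta := saturation G H (set_val @` (phi eta)) in
      homeomorphic_embedding phi /\
      forall eta eta' : cantor_space,
        [/\ [/\ phi eta !=set0, closed (phi eta) & Gdelta (phi eta)],
            E0 eta eta' -> sat_phi eta = sat_phi eta',
            eta <> eta' -> phi eta `&` phi eta' = set0 &
            ~ E0 eta eta' -> sat_phi eta `&` sat_phi eta' = set0]].
Proof.
move=> mon defG [sH _] bH autH FsH sK HK pK NH.
have [sN sL infC satC homC] := mon.
have [F [clF HF]] := Fsigma_closed_over homC sN autH FsH.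
have [B [BH clB]] := closed_filtration defG sN satC sH clF HF.
have [M [eM sM clK [M1 MM] [Mrep Mout]]] := ex_model mon sH bH BH clB pK NH.
have clBM m : closed_over M (B m) := closed_over_sub (@sub0set _ M) (clB m).
have [Y [iY minY]] := ex_minimal_invariant_closed satC sM sK HK clK.
have [_ YK [a Ya] _] := iY; have Ka := YK _ Ya.
have [g [D [k scheme]]] := ex_scheme defG sH BH sK Ka (fun D N =>
  splitting_step defG sN satC sH BH clBM sM M1 MM Mrep Mout sK clK iY minY
    (D := D) N Ya).
have [HG H1 HM HV] := sH; have [KG K1 KM KV] := sK.
pose X := branch_set G K g D; pose P := piece G g D.
have clX eta : closed_over M (X eta) := branch_set_closed defG sH M1 MM clK scheme (eta := eta).
have PM eta m : definable_over M (P eta m) := piece_definable defG sH M1 MM scheme eta m.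
have clP eta m := closed_over_definable (PM eta m).
have sep := piece_separated sH BH M1 MM scheme.
have Psame eta eta' m : cylinder eta m eta' -> P eta' m = P eta m.
  by move=> e; rewrite /P /piece (branch_eq G g e).
pose phi (eta : cantor_space) : sub_vietoris (set_type (types_of M K)) :=
  types_in (M := M) (K := K) (X eta).
have phiE eta : phi eta = \bigcap_m types_in (M := M) (K := K) (P eta m).
  apply/seteqP; split=> p; have [x Kx xp] := types_realized p.
    by move=> [y [_ Py] yp] m _; exists y => //; exact: Py.
  move=> Pp; exists x => //; split=> // m.
  exact/(types_inP (clP eta m) xp)/Pp.
have phi0 eta : phi eta !=set0.
  have [x [Kx Px]] := branch_set_nonempty defG satC sH sM M1 MM sK HK clK Ka scheme eta.
  have Kp : types_of M K (tp M x) by exists x.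
  by exists (exist (fun p => p \in types_of M K) _ (mem_set Kp)); exists x.
have phi_disj eta eta' : eta <> eta' -> phi eta `&` phi eta' = set0.
  move=> ne; apply/seteqP; split=> // p [[x Xx xp]].
  move=> /(types_inP (clX eta') xp) Xx'; apply: ne; apply: funext => i.
  exact: (piece_prefix sH BH M1 MM sK scheme Xx (Xx'.2 i.+1) (ltnSn i)).
have phi_prefix eta eta' m : phi eta' `<=` types_in (M := M) (K := K) (P eta m) ->
    cylinder eta m eta'.
  move=> sub; have [p /[dup] [[x Xx xp]] /sub] := phi0 eta'.
  move=> /(types_inP (clP eta m) xp) Px i.
  exact: (piece_prefix sH BH M1 MM sK scheme Xx Px).
have phi_cts : continuous phi.
  apply: continuous_sub_vietoris => eta W clW phiW.
  have [m PW] : exists m, forall p, W p -> ~ types_in (M := M) (K := K) (P eta m) p.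
    apply: contrapT => /forallNP noW.
    suff [x [Kx [p Wp xp]] Xx] : exists2 x, K x /\ (exists2 p, W p & tp M x = val p)
        & X eta x.
      by have : (phi eta `&` W) p by [split=> //; exists x]; rewrite phiW.
    apply: (branch_set_compact defG satC sH sM M1 MM scheme).
    - exact: closed_over_types_realized.
    - by move=> x [].
    - move=> m; have /existsNP[p /not_implyP[Wp /contrapT [x Px xp]]] := noW m.
      exists x => //; split; last by exists p.
      have [y Ky yp] := types_realized p.
      by apply: (closed_over_same_type clK _ Ky); apply/tp_same_type; rewrite yp.
  apply: filterS (cylinder_nbhs eta m) => eta' /Psame Peta'.
  apply/seteqP; split=> // p [].
  by rewrite phiE => /(_ m I); rewrite Peta' => Pp /PW.
exists M; split=> //; exists phi => sat_phi; split.
  split=> // [eta eta' e|U oU].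
    apply: contrapT => /phi_disj; rewrite e setIid => phie.
    by have := phi0 eta'; rewrite phie => -[].
  pose V := \bigcup_(c in [set c : cantor_space * nat | cylinder c.1 c.2 `<=` U])
    avoiding (~` types_in (M := M) (K := K) (P c.1 c.2)).
  have phiV eta m : avoiding (~` types_in (M := M) (K := K) (P eta m)) =
      [set A | A `<=` types_in (M := M) (K := K) (P eta m)].
    apply/seteqP; split=> A; first by move/disjoints_subset; rewrite setCK.
    by move=> ?; apply/disjoints_subset; rewrite setCK.
  exists V.
    apply: bigcup_open => -[eta m] _; apply: open_avoiding.
    by apply: open_closedC; exact: open_types_in.
  apply/seteqP; split=> [_ [eta Ueta <-]|q [[[eta m] /= sU Vq] [eta' _ phiq]]].
    split; last by exists eta.
    have [m mU] := cylinder_base oU Ueta; exists (eta, m) => //=.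
    by rewrite phiV /= phiE => p; exact.
  by move: Vq; rewrite phiV -phiq => /phi_prefix/sU Ueta'; exists eta'.
move=> eta eta'.
(* the saturation consists of the types of the elements in H-cosets of X e *)
have satP e q : sat_phi e q <-> types_of M (gset G) q /\
    exists x y c, [/\ X e x, tp M y = q, H c & gmul G c x = y].
  split=> [[Gq [_ [p [z Xz zp] <-] [x [y [xp yq Exy]]]]]|[Gq [x [y [c [Xx yq Hc cx]]]]]].
    split=> //; have Xx : X e x.
      by apply: (closed_over_same_type (clX e) _ Xz); apply/tp_same_type; rewrite zp xp.
    have /same_rcosetP[//||c Hc cx] := Exy; first exact: (KG _ Xx.1).
    by exists x, y, c.
  split=> //; exists (tp M x).
    have Kp : types_of M K (tp M x) by exists x => //; exact: Xx.1.
    by exists (exist (fun p => p \in types_of M K) _ (mem_set Kp)) => //; exists x.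
  exists x, y; split=> //; apply/same_rcosetP => //; first exact: (KG _ Xx.1).
  by exists c.
have XG e x : X e x -> gset G x by move=> [/KG].
split; last first.
- move=> NE; apply/seteqP; split=> // q [/satP[_ [x [y [c [Xx yq Hc cx]]]]]].
  move=> /satP[_ [x' [y' [c' [Xx' yq' Hc' cx']]]]].
  have [Gx Gx'] := (XG _ _ Xx, XG _ _ Xx').
  have Gy : gset G y by rewrite -cx; apply: gmul_in => //; exact: HG.
  have Gy' : gset G y' by rewrite -cx'; apply: gmul_in => //; exact: HG.
  have yy' : same_type M y y' by apply/tp_same_type; rewrite yq.
  have [r [Gr Mr Hyr]] := Mrep y Gy; have [HB _ _ _] := BH.
  have /HB[m Byr] := Hyr.
  have [_ By'r] : gset G y' /\ B m (gmul G y' r).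
    have clBr := closed_over_rtranslate defG Mr Gr (clBM m).
    exact: (closed_over_same_type clBr yy').
  (* y and y' lie in the same coset, so some d in H carries x to x' *)
  pose e := gmul G (gmul G y' r) (ginv G (gmul G y r)).
  have He : H e by apply: HM; [exact: (filtrationS BH By'r)|exact: HV].
  have ey : gmul G e y = y' by exact: gmul_ratio.
  pose d := gmul G (ginv G c') (gmul G e c).
  have Hd : H d := HM _ _ (HV _ Hc') (HM _ _ He Hc).
  have [Gc Gc' Ge] := And3 (HG _ Hc) (HG _ Hc') (HG _ He).
  have dx : gmul G d x = x'.
    rewrite /d -gmulA//; [|exact: ginv_in|exact: gmul_in].
    by rewrite -gmulA// cx ey -cx' gKmulV.
  have /HB[j Bd] := Hd; apply: NE; exists j => // i /= ji; apply: contrapT => ne.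
  apply: (sep _ _ _ _ _ _ ne (filtration_le sH BH ji Bd) (Xx.2 i.+1) (Xx'.2 i.+1)).
  exact: dx.
- exact: phi_disj.
- have sat_sub e e' : E0 e e' -> sat_phi e `<=` sat_phi e'.
    move=> [N _ eN] q /satP[Gq [x [y [c [Xx yq Hc cx]]]]]; apply/satP; split=> //.
    have [c0 Hc0 Xc0x] := branch_set_tail sH M1 MM sK HK scheme eN Xx.
    exists (gmul G c0 x), y, (gmul G c (ginv G c0)); split=> //.
      by apply: HM => //; exact: HV.
    have [Gc Gc0 Gx] := And3 (HG _ Hc) (HG _ Hc0) (XG _ _ Xx).
    rewrite -gmulA ?gKmulV//; [exact: ginv_in|exact: gmul_in].
  move=> e; apply/seteqP; split; apply: sat_sub => //.
  by apply: filterS e => i ->.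
- split; first exact: phi0.
    by rewrite phiE; apply: closed_bigI => m _; exact: closed_types_in.
  by exists (fun m => types_in (M := M) (K := K) (P eta m)) => // m; exact: open_types_in.
Qed.
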